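(* Let $n\ge2$. In the semidirect product $\mathcal{B}_n\ltimes C_2^{*n}$, the subgroup $\mathcal{B}_n\ltimes\Phi_{n-1}$ is isomorphic to $\mathrm{Art}\langle D_n\rangle$ via an isomorphism with $d_i\mapsto\sigma_i$ for $i\in\{1,\dots,n-1\}$ and $d_n\mapsto\sigma_{n-1}\tau_n\tau_{n-1}$.
   Context: $C_2^{*n}$ is the group with generators $\tau_1,\dots,\tau_n$ and relations $\tau_k^2=1$. $\Sigma_{0,1,n}$ is the free group on $t_1,\dots,t_n$, with $z_1=(t_1\cdots t_n)^{-1}$. Automorphisms act on the right as exponents and compose left to right, and $a^b:=b^{-1}ab$. $\mathcal{B}_n$ is the group of automorphisms of $\Sigma_{0,1,n}$ fixing $z_1$ and permuting the conjugacy classes $\{[t_1],\dots,[t_n]\}$. It is generated by $\sigma_1,\dots,\sigma_{n-1}$, where $t_k^{\sigma_i}=t_k$ for $k\notin\{i,i+1\}$, $t_i^{\sigma_i}=t_{i+1}$ and $t_{i+1}^{\sigma_i}=t_{i+1}^{-1}t_it_{i+1}$. Each element of $\mathcal{B}_n$ induces an automorphism of $C_2^{*n}$ via $t_k\mapsto\tau_k$. In particular $\sigma_i$ acts by $\tau_k\mapsto\tau_k$ for $k\notin\{i,i+1\}$, $\tau_i\mapsto\tau_{i+1}$ and $\tau_{i+1}\mapsto\tau_{i+1}\tau_i\tau_{i+1}$. This gives a faithful right action of $\mathcal{B}_n$ on $C_2^{*n}$. The semidirect product $\mathcal{B}_n\ltimes C_2^{*n}$ satisfies $\phi^{-1}g\phi=g^\phi$.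 $\Phi_{n-1}$ is the subgroup of $C_2^{*n}$ consisting of the elements that are products of an even number of generators $\tau_k$. It is free of rank $n-1$ and $\mathcal{B}_n$-invariant. $\mathrm{Art}\langle D_n\rangle$ is the group with generators $d_1,\dots,d_n$ and the following relations. For each pair $\{i,j\}$ in $\{\{1,2\},\{2,3\},\dots,\{n-2,n-1\},\{n-2,n\}\}$ (pairs with an index $\le0$ omitted), $d_id_jd_i=d_jd_id_j$. For every other pair $i\ne j$, $d_id_j=d_jd_i$. *)

(* Defs.v *)
From mathcomp Require Import all_boot all_fingroup.
From Stdlib Require Import Relations.
Set Implicit Arguments. Unset Strict Implicit. Unset Printing Implicit Defensive.

(* Conventions: everything is 0-indexed.  The paper's t_{k+1}, tau_{k+1},
   sigma_{k+1}, d_{k+1} are our letter k. *)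

(* a letter (k, b) is t_k if b = false and t_k^{-1} if b = true. *)
Definition fword := seq (nat * bool).

Definition finv (w : fword) : fword := rev (map (fun x => (x.1, ~~ x.2)) w).

Definition fred (w : fword) : fword :=
  foldr (fun x acc => match acc with
                      | y :: acc' => if (y.1 == x.1) && (y.2 != x.2) then acc'
                                     else x :: acc
                      | [::] => [:: x] end) [::] w.

(* An endomorphism of the free group, given by the (reduced) images of
   t_0, ..., t_{n-1}. *)
Definition fendo := seq fword.

Definition fimg (phi : fendo) (k : nat) : fword := nth [::] phi k.

Definition fapp (phi : fendo) (w : fword) : fword :=
  fred (flatten (map (fun x => if x.2 then finv (fimg phi x.1) else fimg phi x.1) w)).

(* composition left to right:  t^(phi psi) = (t^phi)^psi *)
Definition fcomp (phi psi : fendo) : fendo := map (fapp psi) phi.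

Definition fid (n : nat) : fendo := map (fun k => [:: (k, false)]) (iota 0 n).

Definition is_fword (n : nat) (w : fword) : bool :=
  (fred w == w) && all (fun x => x.1 < n) w.

Definition is_endo (n : nat) (phi : fendo) : bool :=
  (size phi == n) && all (is_fword n) phi.

Definition is_aut (n : nat) (phi : fendo) : Prop :=
  is_endo n phi /\
  exists psi, is_endo n psi /\ fcomp phi psi = fid n /\ fcomp psi phi = fid n.

Definition z1 (n : nat) : fword := finv (map (fun k => (k, false)) (iota 0 n)).

(* The group B_n : automorphisms fixing z_1 and permuting the conjugacy
   classes [t_1], ..., [t_n]  (t_k^phi = w_k^{-1} t_{p k} w_k). *)
Definition inBn (n : nat) (phi : fendo) : Prop :=
  is_aut n phi /\ fapp phi (z1 n) = z1 n /\
  exists (p : {perm 'I_n}) (w : seq fword),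
    forall k : 'I_n,
      fimg phi k = fred (finv (nth [::] w k) ++ (nat_of_ord (p k), false) :: nth [::] w k).

Definition cword := seq nat.

Definition cred (g : cword) : cword :=
  foldr (fun x acc => match acc with
                      | y :: acc' => if y == x then acc' else x :: acc
                      | [::] => [:: x] end) [::] g.

Definition is_cword (n : nat) (g : cword) : bool :=
  (cred g == g) && all (fun k => k < n) g.

(* induced action t_k |-> tau_k :  g^phi *)
Definition cact (phi : fendo) (g : cword) : cword :=
  cred (flatten (map (fun k => map fst (fimg phi k)) g)).

(* element (phi, g) stands for phi * g ; phi^{-1} g phi = g^phi. *)
Definition sdelt := (fendo * cword)%type.

Definition sdmul (x y : sdelt) : sdelt :=
  (fcomp x.1 y.1, cred (cact y.1 x.2 ++ y.2)).

Definition sdone (n : nat) : sdelt := (fid n, [::]).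

Definition inBnPhi (n : nat) (x : sdelt) : Prop :=
  inBn n x.1 /\ is_cword n x.2 /\ ~~ odd (size x.2).

Definition sigma (n i : nat) : fendo :=
  map (fun k => if k == i then [:: (i.+1, false)]
                else if k == i.+1 then [:: (i.+1, true); (i, false); (i.+1, false)]
                else [:: (k, false)]) (iota 0 n).

Definition sigma_inv (n i : nat) : fendo :=
  map (fun k => if k == i then [:: (i, false); (i.+1, false); (i, true)]
                else if k == i.+1 then [:: (i, false)]
                else [:: (k, false)]) (iota 0 n).

Definition dimg (n i : nat) : sdelt :=
  if i < n.-1 then (sigma n i, [::]) else (sigma n n.-2, [:: n.-1; n.-2]).

(* image of d_i^{-1}: (phi, g)^{-1} = (phi^{-1}, (g^{-1})^(phi^{-1})) *)
Definition dimg_inv (n i : nat) : sdelt :=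
  if i < n.-1 then (sigma_inv n i, [::])
  else (sigma_inv n n.-2, cact (sigma_inv n n.-2) (rev [:: n.-1; n.-2])).

Definition aword := seq (nat * bool).

Definition is_aword (n : nat) (u : aword) : bool := all (fun x => x.1 < n) u.

(* Dynkin diagram D_n (0-indexed): edges {i,i+1} for i+1 <= n-2 and
   {n-3, n-1} (present only when n >= 3, i.e. index n-2 >= 1 in 1-indexing). *)
Definition adjD (n i j : nat) : bool :=
  (((i.+1 == j) || (j.+1 == i)) && (i < n.-1) && (j < n.-1))
  || ((3 <= n) && (((i == n - 3) && (j == n - 1)) || ((j == n - 3) && (i == n - 1)))).

Definition art_rel (n : nat) (l r : aword) : Prop :=
  (exists i b, i < n /\ l = [:: (i, b); (i, ~~ b)] /\ r = [::])
  \/ (exists i j, [/\ i < n, j < n, i != j & adjD n i j] /\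
        l = [:: (i, false); (j, false); (i, false)] /\
        r = [:: (j, false); (i, false); (j, false)])
  \/ (exists i j, [/\ i < n, j < n, i != j & ~~ adjD n i j] /\
        l = [:: (i, false); (j, false)] /\ r = [:: (j, false); (i, false)]).

Definition art_step (n : nat) (u v : aword) : Prop :=
  exists a b l r, [/\ u = a ++ l ++ b, v = a ++ r ++ b & art_rel n l r].

Definition art_eq (n : nat) : relation aword := clos_refl_sym_trans _ (art_step n).

Definition aeval (n : nat) (u : aword) : sdelt :=
  foldr (fun x acc => sdmul (if x.2 then dimg_inv n x.1 else dimg n x.1) acc)
        (sdone n) u.

(* Main.v *)
From Stdlib Require Import Relations.
From HB Require Import structures.
From mathcomp Require Import all_boot all_fingroup.
From mathcomp Require Import boolp.
Require Import Defs.

Set Implicit Arguments. Unset Strict Implicit. Unset Printing Implicit Defensive.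

(* Well-definedness is a computation with the relations.

   Injectivity.  Let r be the retraction of Art<D_n> onto the subgroup generated
   by d_1, ..., d_{n-1} with r(d_n) = d_{n-1}.  With Y_n = 1,
   Y_{n-1} = d_{n-1}^-1 d_n and Y_k = d_k Y_{k+1} d_k^-1, the assignment
   tau_a tau_b |-> Y_a^-1 Y_b defines a homomorphism Theta from Phi_{n-1} to
   Art<D_n>, and the relations of type D_n say exactly that conjugation by d_i
   corresponds to the action of sigma_i.  Hence every u equals
   r(u) Theta(g), where g is the C_2^{*n}-component of the image of u, and the
   kernel is trivial as soon as the braid group acts faithfully on the free group.

   Faithfulness.  By combing, a braid word equals beta w c with beta a braid word
   on one strand fewer, w a word in the generators A_k of the group of pushes
   of the last point, and c a coset representative of the stabiliser of the
   last point.  Since A_k sends t_m to its conjugate by t_k t_m, modulo t_m the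
   word w can be read off from the image of t_m; so if the braid acts trivially,
   then c and w are trivial, and beta is trivial by induction.

   Surjectivity.  Artin's argument: unless phi is the identity, equality of
   t_1 ... t_n with the product of the images of the t_k forces some central
   letter to be absorbed by a neighbouring conjugate, and then composing phi
   with a sigma_i or its inverse shortens the images.  The elements
   tau_n tau_k are the images of the Y_k. *)

Local Open Scope group_scope.

(** * Free reduction of words *)

Definition flip (x : nat * bool) : nat * bool := (x.1, ~~ x.2).

Lemma flipK : involutive flip.
Proof. by case=> k b; rewrite /flip /= negbK. Qed.

Lemma finvE w : finv w = rev (map flip w).
Proof. by []. Qed.

Lemma finv_cat u v : finv (u ++ v) = finv v ++ finv u.
Proof. by rewrite !finvE map_cat rev_cat. Qed.

Lemma finv_cons x u : finv (x :: u) = rcons (finv u) (flip x).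
Proof. by rewrite !finvE /= rev_cons. Qed.

Lemma finv_rcons x u : finv (rcons u x) = flip x :: finv u.
Proof. by rewrite !finvE map_rcons rev_rcons. Qed.

Lemma finvK : involutive finv.
Proof.
by elim=> [|x u IH] //; rewrite finv_cons finv_rcons IH flipK.
Qed.

Lemma size_finv w : size (finv w) = size w.
Proof. by rewrite finvE size_rev size_map. Qed.

Lemma all_finv (P : pred nat) w :
  all (fun x => P x.1) (finv w) = all (fun x => P x.1) w.
Proof. by rewrite finvE all_rev all_map. Qed.

(** The step of the fold in [fred], named so that [fred] can be unfolded one letter at a time. *)
Definition fcons (x : nat * bool) (acc : fword) : fword :=
  if acc is y :: acc' then
    if (y.1 == x.1) && (y.2 != x.2) then acc' else x :: acc
  else [:: x].
Arguments fcons : simpl never.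

Lemma fred_cons x w : fred (x :: w) = fcons x (fred w).
Proof. by []. Qed.

(** Being reduced is a condition on adjacent letters only; as [sorted compat] it is accessible to
    the lemmas on sorted sequences. *)
Definition compat (x y : nat * bool) := y != flip x.

Lemma compatE x y : compat x y = ~~ ((y.1 == x.1) && (y.2 != x.2)).
Proof.
case: x y => k b [l c]; rewrite /compat /flip xpair_eqE /=.
by case: (l == k) => //=; case: b; case: c.
Qed.

Lemma fconsE x y w : fcons x (y :: w) = if compat x y then [:: x, y & w] else w.
Proof. by rewrite /fcons compatE; case: ifP. Qed.

Lemma compat_flip x y : compat (flip x) (flip y) = compat x y.
Proof. by rewrite /compat (inj_eq (inv_inj flipK)). Qed.

Lemma compat_sym x y : compat x y = compat y x.
Proof. by rewrite /compat -(inv_eq flipK) eq_sym. Qed.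

Lemma fcons_reduced x w : sorted compat w -> sorted compat (fcons x w).
Proof.
case: w => [|y w] // Hw; rewrite fconsE; case: ifP => [/= -> //|_].
exact: path_sorted Hw.
Qed.

Lemma fred_reduced w : sorted compat (fred w).
Proof. by elim: w => [|x w IH] //; rewrite fred_cons fcons_reduced. Qed.

Lemma reduced_fred w : sorted compat w -> fred w = w.
Proof.
elim: w => [|x [|y w] IH] // Hw.
rewrite fred_cons IH ?(path_sorted Hw) // fconsE.
by case/andP: Hw => ->.
Qed.

Lemma freducedP w : reflect (fred w = w) (sorted compat w).
Proof.
by apply: (iffP idP) => [|<-]; [apply: reduced_fred | apply: fred_reduced].
Qed.

Lemma fred_id w : fred (fred w) = fred w.
Proof. exact/freducedP/fred_reduced. Qed.

Lemma fconsK x w : sorted compat w -> fcons (flip x) (fcons x w) = w.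
Proof.
case: w => [|y w] Hw.
  by rewrite [fcons x _]/fcons fconsE /compat flipK eqxx.
rewrite (fconsE x); case: ifP => xy.
  by rewrite fconsE /compat flipK eqxx.
have {xy} Ey : y = flip x by apply/eqP/negbFE.
rewrite -Ey; case: w Hw => [|z w] // Hw.
by rewrite fconsE; case/andP: Hw => ->.
Qed.

Lemma fred_cat u v : fred (u ++ v) = foldr fcons (fred v) u.
Proof. by elim: u => [|x u IH] //; rewrite cat_cons fred_cons IH. Qed.

Lemma foldr_fcons_reduced u acc :
  sorted compat acc -> sorted compat (foldr fcons acc u).
Proof. by move=> Ha; elim: u => [|x u IH] //; apply: fcons_reduced. Qed.

(** Van der Waerden's argument: letters act on reduced words through [fcons], and opposite letters
    act by inverse maps ([fconsK]), so deleting a cancelling pair from [u] does not change its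
    action. *)
Lemma fred_catl u v : fred (fred u ++ v) = fred (u ++ v).
Proof.
rewrite !fred_cat; have: sorted compat (fred v) by apply: fred_reduced.
move: (fred v) => acc Ha; elim: u => [|x u IH] //.
rewrite fred_cons [RHS]/= -IH; case: (fred u) => [|y w] //.
rewrite fconsE; case: ifP => // /negbFE/eqP ->.
by rewrite /= -{1}[x]flipK fconsK // foldr_fcons_reduced.
Qed.

Lemma fred_catr u v : fred (u ++ fred v) = fred (u ++ v).
Proof. by rewrite !fred_cat fred_id. Qed.

Lemma fred_finvl w : fred (finv w ++ w) = [::].
Proof.
elim: w => [|x w IH] //.
by rewrite finv_cons cat_rcons -fred_catr !fred_cons fconsK ?fred_reduced // fred_catr IH.
Qed.

Lemma fred_finvr w : fred (w ++ finv w) = [::].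
Proof. by rewrite -{1}[w]finvK fred_finvl. Qed.

Lemma finv_reduced w : sorted compat (finv w) = sorted compat w.
Proof.
rewrite finvE rev_sorted sorted_map.
by apply: eq_sorted => x y /=; rewrite compat_flip compat_sym.
Qed.

Lemma all_fred (P : pred nat) w :
  all (fun x => P x.1) w -> all (fun x => P x.1) (fred w).
Proof.
elim: w => [|x w IH] // /andP[Px /IH]; rewrite fred_cons.
case: (fred w) => [|y v]; first by rewrite /= Px.
by rewrite fconsE; case: ifP => [_|_ /andP[]//]; rewrite /= Px.
Qed.

(** * The free group on countably many letters *)

(** A single group of infinite rank serves all [n]; the rank enters only through bounds on the
    letters. *)
Definition freegrp := {w : fword | fred w == w}.
HB.instance Definition _ := Choice.on freegrp.

Definition tofree (w : fword) : freegrp := exist _ (fred w) (introT eqP (fred_id w)).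

Definition free_mul (u v : freegrp) := tofree (val u ++ val v).
Definition free_inv (u : freegrp) := tofree (finv (val u)).

Lemma free_mulA : associative free_mul.
Proof. by move=> u v w; apply: val_inj; rewrite /= fred_catr fred_catl catA. Qed.
Lemma free_mul1 : left_id (tofree [::]) free_mul.
Proof. by move=> u; apply: val_inj; rewrite /=; apply/eqP/(valP u). Qed.
Lemma free_mulr1 : right_id (tofree [::]) free_mul.
Proof. by move=> u; apply: val_inj; rewrite /= cats0; apply/eqP/(valP u). Qed.
Lemma free_mulV : left_inverse (tofree [::]) free_inv free_mul.
Proof. by move=> u; apply: val_inj; rewrite /= fred_catl fred_finvl. Qed.
Lemma free_mulrV : right_inverse (tofree [::]) free_inv free_mul.
Proof. by move=> u; apply: val_inj; rewrite /= fred_catr fred_finvr. Qed.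

HB.instance Definition _ :=
  isGroup.Build freegrp free_mulA free_mul1 free_mulr1 free_mulV free_mulrV.

Definition tgen (k : nat) : freegrp := tofree [:: (k, false)].

(** * Values of words in a group *)

Section WordValue.
Variable G : groupType.
Implicit Types (d : nat -> G) (w : fword).

Definition lval d (x : nat * bool) : G := if x.2 then (d x.1)^-1 else d x.1.
Definition wval d w : G := foldr (fun x g => lval d x * g) 1 w.

Lemma wval_cons d x w : wval d (x :: w) = lval d x * wval d w.
Proof. by []. Qed.

Lemma wval1 d x : wval d [:: x] = lval d x.
Proof. exact: mulg1. Qed.

Lemma wval_cat d u v : wval d (u ++ v) = wval d u * wval d v.
Proof. by elim: u => [|x u IH]; rewrite ?mul1g //= IH mulgA. Qed.

Lemma lval_flip d x : lval d (flip x) = (lval d x)^-1.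
Proof. by case: x => k []; rewrite /lval //= invgK. Qed.

Lemma wval_finv d w : wval d (finv w) = (wval d w)^-1.
Proof.
elim: w => [|x w IH]; first by rewrite /= invg1.
by rewrite finv_cons -cats1 wval_cat wval1 IH lval_flip /= invgM.
Qed.

Lemma wval_fred d w : wval d (fred w) = wval d w.
Proof.
elim: w => [|x w IH] //; rewrite fred_cons wval_cons -IH.
case: (fred w) => [|y v] //; rewrite fconsE.
by case: ifP => // /negbFE/eqP ->; rewrite wval_cons lval_flip mulVKg.
Qed.

Lemma eq_wval_in (P : pred nat) d d' w :
    (forall k, P k -> d k = d' k) -> all (fun x => P x.1) w ->
  wval d w = wval d' w.
Proof.
move=> E; elim: w => [|[k b] w IH] // /andP[/= Pk /IH ->].
by rewrite /lval /= E.
Qed.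

Lemma wvalJ d w g : wval (fun k => d k ^ g) w = wval d w ^ g.
Proof.
elim: w => [|[k b] w IH]; first by rewrite /= conj1g.
by rewrite /= IH conjMg /lval /=; case: b; rewrite ?conjVg.
Qed.

Lemma wval_commute d w g :
  (forall x, x \in w -> commute g (d x.1)) -> commute g (wval d w).
Proof.
elim: w => [|[k b] w IH] H; first exact: commute1.
apply: commuteM; last by apply: IH => x Hx; apply: H; rewrite inE Hx orbT.
have := H (k, b); rewrite inE eqxx => /(_ isT) /=.
by rewrite /lval /=; case: (b) => //; apply: commuteV.
Qed.

End WordValue.

Lemma wval_tgen w : wval tgen w = tofree w.
Proof.
elim: w => [|x w IH]; first exact: val_inj.
rewrite wval_cons IH; apply: val_inj; case: x => k b.
by transitivity (fred ([:: (k, b)] ++ fred w)); [case: b | rewrite fred_catr].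
Qed.

Lemma tofree_eqP u v : tofree u = tofree v <-> fred u = fred v.
Proof. by split=> [[]//|E]; apply: val_inj. Qed.

(** This is [fapp] before free reduction, with the images given by a function instead of a table. *)
Definition fsubst (f : nat -> fword) (w : fword) : fword :=
  flatten [seq if x.2 then finv (f x.1) else f x.1 | x <- w].

Lemma wval_fsubst (G : groupType) (d : nat -> G) f w :
  wval d (fsubst f w) = wval (fun k => wval d (f k)) w.
Proof.
elim: w => [|[k b] w IH] //; rewrite /fsubst /= wval_cat IH /lval /=.
by case: b; rewrite ?wval_finv.
Qed.

Lemma all_fsubst (P : pred nat) f w :
    (forall k, P k -> all (fun x => P x.1) (f k)) ->
  all (fun x => P x.1) w -> all (fun x => P x.1) (fsubst f w).
Proof.
move=> Pf; elim: w => [|[k b] w IH] //= /andP[Pk /IH Pw].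
by rewrite /fsubst /= all_cat [all _ (flatten _)]Pw andbT; case: b; rewrite ?all_finv Pf.
Qed.

(** * The group of bijections of a type *)

(** The inverse is part of the data, so that inversion computes in the group of bijections, where
    braid words are evaluated. *)
Record bij (T : Type) := Bij {
  bfun :> T -> T; binv : T -> T; bfunK : cancel bfun binv; binvK : cancel binv bfun }.

Lemma bij_eqP (T : Type) (f g : bij T) : bfun f = bfun g -> f = g.
Proof.
case: f g => f f' fK f'K [g g' gK g'K] /= E; subst g.
have E' : f' = g' by apply: funext => x; rewrite -[x in f' x]g'K fK.
by subst g'; rewrite (Prop_irrelevance fK gK) (Prop_irrelevance f'K g'K).
Qed.

HB.instance Definition _ T := gen_eqMixin (bij T).
HB.instance Definition _ T := gen_choiceMixin (bij T).

Section BijGroup.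
Variable T : Type.

Definition bij_one : bij T := @Bij T id id (fun=> erefl) (fun=> erefl).
Definition bij_mul (f g : bij T) : bij T :=
  Bij (can_comp (bfunK f) (bfunK g)) (can_comp (binvK g) (binvK f)).
Definition bij_inv (f : bij T) : bij T := Bij (binvK f) (bfunK f).

Lemma bij_mulA : associative bij_mul. Proof. by move=> *; apply: bij_eqP. Qed.
Lemma bij_mul1 : left_id bij_one bij_mul. Proof. by move=> *; apply: bij_eqP. Qed.
Lemma bij_mulr1 : right_id bij_one bij_mul. Proof. by move=> *; apply: bij_eqP. Qed.
Lemma bij_mulV : left_inverse bij_one bij_inv bij_mul.
Proof. by move=> f; apply/bij_eqP/funext => x; apply: bfunK. Qed.
Lemma bij_mulrV : right_inverse bij_one bij_inv bij_mul.
Proof. by move=> f; apply/bij_eqP/funext => x; apply: binvK. Qed.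

HB.instance Definition _ :=
  isGroup.Build (bij T) bij_mulA bij_mul1 bij_mulr1 bij_mulV bij_mulrV.

Lemma bij_mulE (f g : bij T) x : (f * g) x = f (g x).
Proof. by []. Qed.

Lemma bij_invE (f : bij T) x : f^-1 x = binv f x.
Proof. by []. Qed.

End BijGroup.

(** * Hurwitz moves *)

Lemma neqSn i : (i.+1 == i = false) * (i == i.+1 = false)
  * (i.+2 == i = false) * (i == i.+2 = false).
Proof. by elim: i. Qed.

Section Hurwitz.
Variable G : groupType.
Implicit Types x y : nat -> G.

(* The action of sigma_i, resp. its inverse, on homomorphisms from the free
   group to [G], which we identify with the sequences of images of the t_k. *)
Definition hur i x k : G :=
  if k == i then x i.+1 else if k == i.+1 then x i ^ x i.+1 else x k.
Definition hurV i x k : G :=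
  if k == i then x i.+1 ^ (x i)^-1 else if k == i.+1 then x i else x k.

Lemma hurK i : cancel (hur i) (hurV i).
Proof.
move=> x; apply: funext => k; rewrite /hurV /hur !eqxx !neqSn.
by case: (k =P i) => [->|_]; [rewrite conjgK | case: (k =P i.+1) => [->|]].
Qed.

Lemma hurVK i : cancel (hurV i) (hur i).
Proof.
move=> x; apply: funext => k; rewrite /hurV /hur !eqxx !neqSn.
by case: (k =P i) => [->|_] //; case: (k =P i.+1) => [->|] //; rewrite conjgKV.
Qed.

Definition hurB i : bij (nat -> G) := Bij (hurK i) (hurVK i).

Lemma hur_braid i : hurB i * hurB i.+1 * hurB i = hurB i.+1 * hurB i * hurB i.+1.
Proof.
apply/bij_eqP/funext => x; apply: funext => k; rewrite !bij_mulE /= /hur.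
rewrite !eqxx !eqSS !neqSn.
case: (k =P i) => [->|_]; first by rewrite ?eqxx ?eqSS ?neqSn.
case: (k =P i.+1) => // _; case: (k =P i.+2) => // _.
(* Only the entry at [i.+2] remains. Both sides conjugate [x i], and the two conjugators agree
   because [a * b = b * a ^ b]. *)
by rewrite -!conjgM conjgC.
Qed.

Lemma hur_commute i j : i.+1 < j -> commute (hurB i) (hurB j).
Proof.
move=> ij; apply/bij_eqP/funext => x; apply: funext => k; rewrite !bij_mulE /= /hur.
have E1 : (i == j) = false by rewrite ltn_eqF // ltnW.
have E2 : (i.+1 == j) = false by rewrite ltn_eqF.
have E3 : (i == j.+1) = false by rewrite ltn_eqF // ltnW // ltnW.
rewrite ![j == _]eq_sym ![j.+1 == _]eq_sym !eqSS E1 E2 E3.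
case: (k =P i) => [->|_]; first by rewrite E1 E3.
case: (k =P i.+1) => [->|_] //.
by rewrite E2 eqSS E1.
Qed.

Lemma hur_word_fix m (u : fword) x j :
  all (fun l => l.1 < m) u -> m < j -> wval hurB u x j = x j.
Proof.
move=> + mj; elim: u x => [|[i b] u IH] x //= /andP[/= im /IH {}IH].
rewrite -[RHS]IH; move: (bfun _ x) => y.
have E1 : (j == i) = false by rewrite gtn_eqF // (ltn_trans im).
have E2 : (j == i.+1) = false by rewrite gtn_eqF // (leq_trans _ mj).
by rewrite /lval /=; case: b; rewrite /= ?/hur ?/hurV E1 E2.
Qed.

End Hurwitz.

(** * Combing in a braid group *)

(** Here [m] counts generators, [d 0] to [d m.-1], so this is the braid group on [m.+1] strands. *)
Definition braid_rel (G : groupType) m (d : nat -> G) :=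
  (forall i, i.+1 < m -> d i * d i.+1 * d i = d i.+1 * d i * d i.+1) /\
  (forall i j, i.+1 < j -> j < m -> commute (d i) (d j)).

Lemma braid_relW (G : groupType) m (d : nat -> G) : braid_rel m.+1 d -> braid_rel m d.
Proof. by case=> H1 H2; split=> [i im|i j ij jm]; [apply/H1/ltnW | apply/H2/ltnW]. Qed.

Lemma hur_braid_rel (G : groupType) m : braid_rel m (@hurB G).
Proof. by split=> [i _|i j ij _]; [apply: hur_braid | apply: hur_commute]. Qed.

(* [Aw m k] is the pure braid pushing point m around point k, and [cw m k]
   is a coset representative moving point m to point k.  Conjugating the
   former by the braid generator i, or its inverse, gives [Aconj i b k]. *)
Fixpoint Aw m k : fword :=
  if m is m'.+1 then
    if k == m' then [:: (m', false); (m', false)]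
    else (m', true) :: rcons (Aw m' k) (m', false)
  else [::].

Fixpoint cw m k : fword :=
  if m is m'.+1 then if k <= m' then (m', true) :: cw m' k else [::] else [::].

Definition Aconj i b k : fword :=
  if b then
    if k == i then [:: (i, true); (i.+1, false); (i, false)]
    else if k == i.+1 then [:: (i, false)] else [:: (k, false)]
  else
    if k == i then [:: (i.+1, false)]
    else if k == i.+1 then [:: (i.+1, false); (i, false); (i.+1, true)]
    else [:: (k, false)].

Lemma all_Aw m k : all (fun x => x.1 < m) (Aw m k).
Proof.
elim: m => [|m IH] //=; case: ifP => _ /=; rewrite ltnSn //= all_rcons ltnSn.
by apply: sub_all IH => x /ltnW.
Qed.

Lemma all_cw m k : all (fun x => k <= x.1 < m) (cw m k).
Proof.
elim: m => [|m IH] //=; case: ifP => //= -> /=; rewrite ltnSn.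
by apply: sub_all IH => x /andP[-> /ltnW].
Qed.

Lemma cw_nil m : cw m m = [::].
Proof. by case: m => //= m; rewrite ltnn. Qed.

(** * Identities on three strands *)

Section ThreeStrands.
Variables (G : groupType) (a b : G).
Hypothesis ab : a * b * a = b * a * b.

Lemma braidJ : a ^ b = b ^ a^-1.
Proof.
rewrite !conjgE invgK; apply: (mulgI b); apply: (mulIg a).
by rewrite !mulgA mulgV mul1g mulgVK.
Qed.

Lemma braid_sqrJ : (a * a) ^ b = (b * b) ^ a^-1.
Proof. by rewrite !conjMg braidJ. Qed.

(** The product equals [b * a * a * b], the braid in which the third strand circles the first two;
    it commutes with [a]. *)
Lemma braid_prodJ : (b * b * (a * a) ^ b) ^ a = b * b * (a * a) ^ b.
Proof.
have -> : b * b * (a * a) ^ b = b * a * a * b by rewrite conjgE !mulgA mulgK.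
rewrite conjgE; apply: (mulgI a); rewrite !mulgA mulgV mul1g.
by rewrite ab -!mulgA; congr (_ * (_ * _)); rewrite !mulgA ab.
Qed.

Lemma braid_conjV : b^-1 * a^-1 * b = a * b^-1 * a^-1.
Proof.
apply: (mulgI (a * b)); rewrite !mulgA mulgK mulgV mul1g.
by rewrite ab !mulgK.
Qed.

Lemma braid_inv : b^-1 * a^-1 * b^-1 = a^-1 * b^-1 * a^-1.
Proof. by rewrite -!invgM !mulgA ab. Qed.

End ThreeStrands.

Lemma conjg_commute (G : groupType) (x y : G) : commute y x -> x ^ y = x.
Proof. by rewrite conjgE => <-; rewrite mulKg. Qed.

Lemma conjg_fix_commute (G : groupType) (x y : G) : x ^ y = x -> commute y x.
Proof. by move=> E; rewrite /commute [in RHS]conjgC E. Qed.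

(** * Moving braid generators past pushes and coset representatives *)

Section Combing.
Variables (G : groupType) (d : nat -> G).

Definition Aval m k : G := wval d (Aw m k).
Definition cval m k : G := wval d (cw m k).

Lemma AvalS m k : Aval m.+1 k = if k == m then d m * d m else Aval m k ^ d m.
Proof.
rewrite /Aval /=; case: ifP => _; first by rewrite /= /lval /= mulg1.
by rewrite -cats1 wval_cons wval_cat wval1 conjgE.
Qed.

Lemma cvalS m k : k <= m -> cval m.+1 k = (d m)^-1 * cval m k.
Proof. by rewrite /cval /= => ->. Qed.

Lemma cvalmm m : cval m m = 1.
Proof. by rewrite /cval cw_nil. Qed.

Lemma Aval_commute m g k : (forall i, i < m -> commute g (d i)) -> commute g (Aval m k).
Proof. by move=> H; apply: wval_commute => x /(allP (all_Aw m k)) /H. Qed.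

(** Induction on [m]. If [d i] commutes with the outermost generator, the conjugation descends
    through the recursion of [Aw]. Otherwise that generator is [d i.+1]: for [k] equal to [i] or
    [i.+1] this is a three-strand identity, and for smaller [k] the braid relation moves the
    conjugator to a [d i.+1] that commutes with the inner push. *)
Lemma Aval_conjF m i k : braid_rel m d -> i.+1 < m -> k < m ->
  Aval m k ^ d i = wval (Aval m) (Aconj i false k).
Proof.
elim: m k => [|m IH] k // Hd im km.
have [im' | im'] := ltnP i.+1 m.
  have dim : commute (d i) (d m) by apply: (Hd.2).
  rewrite AvalS; case: (k =P m) => [->|nkm].
    rewrite conjMg conjg_commute // /Aconj !gtn_eqF ?(ltnW im') //.
    by rewrite wval1 /lval /= AvalS eqxx.
  have {}km : k < m by rewrite ltn_neqAle -ltnS km andbT; apply/eqP.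
  rewrite -conjgM -dim conjgM (IH _ (braid_relW Hd)) // -wvalJ.
  apply: (@eq_wval_in _ (fun j => j < m)) => [j jm|].
    by rewrite AvalS ltn_eqF.
  by rewrite /Aconj; do 2?[case: ifP => _ /=]; rewrite ?im' ?km ?(ltnW im').
have Em : m = i.+1 by apply/eqP; rewrite eqn_leq im'.
subst m; have br := Hd.1 i im; rewrite /Aconj.
case: (k =P i) => [->|nki].
  rewrite wval1 /lval /= !AvalS !eqxx !neqSn.
  by rewrite (braid_sqrJ br) conjgKV.
case: (k =P i.+1) => [->|nki1].
  rewrite !wval_cons /= /lval /= mulg1 !AvalS !eqxx !neqSn.
  have := braid_prodJ br; rewrite conjMg (braid_sqrJ br) conjgKV => E.
  by rewrite [RHS]mulgA -E mulgK.
have ki : k < i by rewrite ltn_neqAle -ltnS ltn_neqAle -ltnS km !andbT; apply/andP; split; apply/eqP.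
rewrite wval1 /lval /= AvalS; have /eqP/negPf -> := nki1.
rewrite AvalS; have /eqP/negPf -> := nki.
rewrite -!conjgM ?mulgA br -mulgA [LHS]conjgM; congr (_ ^ _); apply: conjg_commute.
by apply: Aval_commute => j ji; apply/commute_sym/(Hd.2).
Qed.

Lemma Aval_conj m i b k : braid_rel m d -> i.+1 < m -> k < m ->
  Aval m k ^ lval d (i, b) = wval (Aval m) (Aconj i b k).
Proof.
move=> Hd im km; case: b; last exact: Aval_conjF.
have Ei := Aval_conjF Hd im (ltnW im); have Ei1 := Aval_conjF Hd im im.
apply: (conjg_inj (d i)); rewrite /lval /= conjgKV; move: Ei Ei1.
rewrite /Aconj !eqxx !neqSn !wval_cons /= /lval /= !mulg1 => Ei Ei1.
case: (k =P i) => [->|/eqP nki].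
  rewrite !wval_cons /= /lval /= !mulg1 !conjMg conjVg Ei Ei1.
  by rewrite -!mulgA mulVg mulg1 mulKg.
case: (k =P i.+1) => [->|/eqP nki1].
  by rewrite wval1 /lval /= Ei.
rewrite wval1 /lval /= Aval_conjF // /Aconj (negPf nki) (negPf nki1).
by rewrite wval1.
Qed.

Lemma Aword_conj m i b w : braid_rel m d -> i.+1 < m -> all (fun x => x.1 < m) w ->
  wval (Aval m) w * lval d (i, b) = lval d (i, b) * wval (Aval m) (fsubst (Aconj i b) w).
Proof.
move=> Hd im Hw; rewrite conjgC -wvalJ wval_fsubst; congr (_ * _).
by apply: (eq_wval_in (P := fun k => k < m)) Hw => k km; apply: Aval_conj.
Qed.

Lemma cval_commute m i k : braid_rel m d -> i.+1 < k -> commute (d i) (cval m k).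
Proof.
move=> Hd ik; apply: wval_commute => x /(allP (all_cw m k)) /andP[kx xm].
exact: Hd.2 (leq_trans ik kx) xm.
Qed.

(** The representative is the product of the inverses of [d m.-1] down to [d k]. The recursion of
    [cw] peels it on the left; combing needs it peeled on the right. *)
Lemma cval_rec m k : k < m -> cval m k = cval m k.+1 * (d k)^-1.
Proof.
elim: m => [|m IH] //; rewrite ltnS leq_eqVlt => /orP[/eqP ->|km].
  by rewrite cvalS // !cvalmm mulg1 mul1g.
by rewrite !cvalS ?(ltnW km) // IH // mulgA.
Qed.

Lemma Aval_cval m k : k < m -> cval m k.+1 * (d k * d k) = Aval m k * cval m k.+1.
Proof.
elim: m => [|m IH] //; rewrite ltnS leq_eqVlt AvalS => /orP[/eqP ->|km].
  by rewrite eqxx cvalmm mul1g mulg1.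
by rewrite ltn_eqF // cvalS // -mulgA IH // conjgE !mulgA mulgK.
Qed.

(** The letter [d i] commutes with the inverses below index [i.-1], becomes [d i.-1] by one braid
    relation, and then commutes with the inverses above index [i]. *)
Lemma cval_shift m k i : braid_rel m d -> k < i < m ->
  cval m k * d i = d i.-1 * cval m k.
Proof.
elim: m => [|m IH] // Hd; first by rewrite andbF.
case/andP=> ki; rewrite ltnS leq_eqVlt => /orP[/eqP Ei|im].
  subst i; case: m {IH} Hd ki => // m Hd; rewrite ltnS => km.
  rewrite !cvalS ?leqW // -!mulgA /=.
  have <- : commute (d m.+1) (cval m k).
    apply: wval_commute => x /(allP (all_cw m k)) /andP[_ xm].
    exact/commute_sym/(Hd.2).
  rewrite !mulgA; congr (_ * _); have br := Hd.1 m (ltnSn _).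
  by apply: (mulgI (d m.+1)); apply: (mulgI (d m)); rewrite !mulgA mulgK mulgV mul1g br !mulgK.
have dim : commute (d i.-1) (d m).
  by apply: Hd.2 => //; case: (i) ki im.
rewrite cvalS ?(ltnW (ltn_trans ki im)) // -mulgA (IH (braid_relW Hd)) ?ki //.
by rewrite !mulgA (commuteV dim).
Qed.

End Combing.

(** Induction on the word from the right: the new letter either crosses the representative or
    changes it. The words [bw] and [w] and the index [k] are chosen before the group, so information
    read off in the Hurwitz action transfers to every group with the braid relations. *)
Lemma comb m u : all (fun x => x.1 < m) u ->
  exists bw, exists w, exists k,
    [/\ all (fun x => x.1 < m.-1) bw, all (fun x => x.1 < m) w, k <= m
      & forall (G : groupType) (d : nat -> G), braid_rel m d ->
          wval d u = wval d bw * wval (Aval d m) w * cval d m k].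
Proof.
elim/last_ind: u => [|u [i b] IH].
  by exists [::], [::], m; split=> // G d _; rewrite cvalmm !mulg1.
rewrite all_rcons => /andP[/= im /IH[bw [w [k [Hbw Hw km E]]]]].
(* A letter that crosses the representative also crosses the pushes, rewriting them by [Aconj], and
   joins the smaller braid word. *)
have step bb i' : i'.+1 < m ->
    (forall (G : groupType) (d : nat -> G), braid_rel m d ->
      cval d m k * lval d (i, bb) = lval d (i', bb) * cval d m k) ->
  exists bw, exists w, exists k,
    [/\ all (fun x => x.1 < m.-1) bw, all (fun x => x.1 < m) w, k <= m
      & forall (G : groupType) (d : nat -> G), braid_rel m d ->
          wval d (rcons u (i, bb)) = wval d bw * wval (Aval d m) w * cval d m k].
  move=> i'm Hc; exists (rcons bw (i', bb)), (fsubst (Aconj i' bb) w), k; split=> //.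
  - by rewrite all_rcons Hbw andbT /= -ltnS prednK // (leq_ltn_trans _ i'm).
  - apply: (all_fsubst (P := fun j => j < m)) Hw => l lm; rewrite /Aconj.
    by case: bb {Hc}; do 2?[case: ifP => _ /=]; rewrite ?i'm ?(ltnW i'm) ?lm.
  - move=> G d Hd; rewrite -!cats1 !wval_cat !wval1 E //.
    by rewrite -2!mulgA Hc // mulgA !mulgA -[_ * lval _ _ in LHS]mulgA Aword_conj // !mulgA.
have [ik | ki] := ltnP i.+1 k.
  apply: (step _ i) => [|G d Hd]; first exact: leq_trans ik km.
  have := cval_commute Hd ik; rewrite /lval /=; case: b => // H.
  exact/esym/commute_sym/commuteV/commute_sym.
have [{}ki | ik] := ltnP k i.
  have i0 : 0 < i by case: (i) ki.
  apply: (step _ i.-1) => [|G d Hd]; first by rewrite prednK.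
  have H : cval d m k * d i = d i.-1 * cval d m k by apply: cval_shift; rewrite ?ki.
  rewrite /lval /=; case: (b) => //.
  by apply: (mulgI (d i.-1)); apply: (mulIg (d i)); rewrite mulVKg mulgA mulgVK H.
have [Ek | Ek] : k = i \/ k = i.+1.
  move: ik; rewrite leq_eqVlt => /orP[/eqP ->|ik]; first by left.
  by right; apply/eqP; rewrite eqn_leq ki.
(* Multiplying by [d i] turns [cval m i] into [cval m i.+1]. For the inverse letter an extra inverse
   square of [d i] remains, which [Aval_cval] carries to the left as the inverse push. *)
- subst k; exists bw, (if b then rcons w (i, true) else w), i.+1; split=> //.
    by case: b => //; rewrite all_rcons Hw /= im.
  move=> G d Hd; rewrite -cats1 wval_cat wval1 E // (cval_rec _ im).
  case: b; rewrite /lval /= ?mulgA ?mulgVK //.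
  rewrite -cats1 wval_cat wval1 /lval /= -!mulgA; congr (_ * (_ * _)).
  apply: (mulgI (Aval d m i)); rewrite mulVKg [LHS]mulgA -Aval_cval // -!mulgA.
  by rewrite !mulVKg mulgV mulg1.
(* The mirror case: here the positive letter produces a push, and the inverse letter only lowers the
   index of the representative. *)
- subst k; exists bw, (if b then w else rcons w (i, false)), i; split=> //.
  + by case: b => //; rewrite all_rcons Hw /= im.
  + exact: ltnW.
  move=> G d Hd; rewrite -cats1 wval_cat wval1 E // (cval_rec _ im).
  case: b; rewrite /lval /= ?mulgA //.
  rewrite -cats1 wval_cat wval1 /lval /= -!mulgA; congr (_ * (_ * _)).
  by rewrite mulgA -Aval_cval // -!mulgA mulgV mulg1.
Qed.

(** * Faithfulness of the action of the braid group on the free group *)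

Section HurwitzA.
Variable G : groupType.
Implicit Types y : nat -> G.

Lemma hur_Aw_last m k y : k < m -> wval (@hurB G) (Aw m k) y m = y m ^ (y k * y m).
Proof.
rewrite -/(Aval _ _ _).
elim: m y => [|m IH] y //; rewrite ltnS leq_eqVlt AvalS => /orP[/eqP ->|km].
  rewrite eqxx bij_mulE /= /hur !eqxx !neqSn.
  by rewrite conjgC conjgM; congr (_ ^ _); rewrite conjgE mulKg.
rewrite ltn_eqF // conjgE !bij_mulE bij_invE /= {1}/hurV !neqSn eqxx IH //.
by rewrite /hur eqxx (ltn_eqF km) ltn_eqF // ltnW.
Qed.

Variables (H : groupType) (f : G -> H).
Hypotheses (f1 : f 1 = 1) (fM : {morph f : x y / x * y}).

Let fV x : f x^-1 = (f x)^-1.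
Proof. by apply/esym/mulg1_eq; rewrite -fM mulgV. Qed.

Let fJ (a b : G) : f (a ^ b) = f a ^ f b.
Proof. by rewrite !conjgE !fM fV. Qed.

(** Once [f] kills the moving point, circling that point has no effect on the images of the entries
    under [f]. *)
Lemma hur_Aw_ker m k y j : k < m -> f (y m) = 1 ->
  f (wval (@hurB G) (Aw m k) y j) = f (y j).
Proof.
rewrite -/(Aval _ _ _).
elim: m y j => [|m IH] y j //; rewrite ltnS leq_eqVlt AvalS => /orP[/eqP ->|km] fy.
  rewrite eqxx bij_mulE /= /hur !eqxx !neqSn.
  case: (j =P m) => [->|_]; first by rewrite fJ fy conjg1.
  by case: (j =P m.+1) => [->|//]; rewrite fJ fy conj1g.
rewrite ltn_eqF // conjgE !bij_mulE bij_invE /=.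
set z := hur m y; have fz : f (z m) = 1 by rewrite /z /hur eqxx.
have {}IH l : f (Aval (@hurB G) m k z l) = f (z l) by apply: IH.
rewrite /hurV; case: (j =P m) => [->|/eqP nj].
  by rewrite fJ fV !IH fz invg1 conjg1 /z /hur !neqSn !eqxx fJ fy conjg1.
case: (j =P m.+1) => [->|/eqP nj1]; first by rewrite IH fz.
by rewrite IH /z /hur (negPf nj) (negPf nj1).
Qed.

(** Each push multiplies the conjugator of [y m] by an element whose [f]-image is that of [y k].
    Products of bijections apply their rightmost factor first, so the conjugator spells [rev w]. *)
Lemma hur_Aword m w y : all (fun x => x.1 < m) w -> f (y m) = 1 ->
  exists2 g, wval (Aval (@hurB G) m) w y m = y m ^ g /\ f g = wval (f \o y) (rev w)
    & f \o wval (Aval (@hurB G) m) w y =1 f \o y.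
Proof.
move=> + fy; elim: w => [|[k b] w IH] /=; first by exists 1; rewrite ?conjg1.
case/andP=> km /IH[g [Eg fg] Ef].
set z := bfun (wval _ w) y in Eg Ef *.
have fz : f (z m) = 1 by rewrite [LHS]Ef.
rewrite rev_cons -cats1 wval_cat wval1 -fg /lval /=.
case: b.
  (* For an inverse push, the formula of [hur_Aw_last] is applied at the preimage [v] and solved for
     [v m]. *)
  set v := (_^-1 : bij _) z; have Ez : Aval (@hurB G) m k v = z by apply: binvK.
  have Ezm : z m = v m ^ (v k * v m) by rewrite -(hur_Aw_last v km) -/(Aval _ _ _) Ez.
  have fv : f (v m) = 1 by apply/eqP; rewrite -(conjg_eq1 _ (f (v k * v m))) -fJ -Ezm fz.
  have Efv j : f (v j) = f (y j).
    by rewrite -[RHS]Ef /= -Ez -(hur_Aw_ker j km fv).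
  exists (g * (v k * v m)^-1); last by move=> j; apply: Efv.
  by rewrite conjgM -Eg Ezm conjgK fM fV fM fv mulg1 Efv.
exists (g * (z k * z m)).
  by rewrite conjgM -Eg -hur_Aw_last // !fM fz mulg1 [f (z k)]Ef.
by move=> j; rewrite -[RHS]Ef; apply: hur_Aw_ker.
Qed.

Lemma hur_cw_last m k y : k <= m -> wval (@hurB G) (cw m k) y m = y k.
Proof.
elim: m y => [|m IH] y; first by rewrite leqn0 => /eqP ->.
rewrite leq_eqVlt => /orP[/eqP ->|]; first by rewrite cw_nil.
rewrite ltnS => km; rewrite -/(cval _ _ _) cvalS // bij_mulE bij_invE /=.
by rewrite /hurV neqSn eqxx IH.
Qed.

End HurwitzA.

(** * Centralizers of letters in the free group *)

Lemma cons_rcons_const (T : eqType) (x : T) w : x :: w = rcons w x -> all (pred1 x) w.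
Proof. by elim: w => [|y w IH] //= [<- /IH ->]; rewrite eqxx. Qed.

Lemma fred_rcons w x : sorted compat w ->
  fred (rcons w x) = rcons w x \/ exists2 v, w = rcons v (flip x) & fred (rcons w x) = v.
Proof.
case/lastP: w => [|w y] Hw; first by left.
have [xy | /negPn/eqP ->] := boolP (compat y x); last first.
  right; exists w; rewrite ?flipK //.
  have E : fred [:: y; flip y] = [::] by exact: (fred_finvr [:: y]).
  rewrite -!cats1 -catA -fred_catr E cats0.
  by apply/freducedP; move: Hw; rewrite -cats1 => /cat_sorted2 [].
left; apply/freducedP; case: w Hw => [|z w]; first by rewrite /= xy.
by rewrite /= [path _ _ (rcons (rcons _ _) _)]rcons_path last_rcons xy andbT.
Qed.

(** Comparing lengths, [x] cancels against [w] on both sides or on neither. In both situations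
    prepending and appending the same letter to [w] agree, so [w] is constant. *)
Lemma centralizer_word w x : sorted compat w ->
  fred (x :: w) = fred (rcons w x) -> all (fun y => y.1 == x.1) w.
Proof.
move=> Hw; have Ew := reduced_fred Hw.
have aux (z : nat * bool) : z.1 = x.1 -> z :: w = rcons w z -> all (fun y => y.1 == x.1) w.
  by move=> <- /cons_rcons_const; apply: sub_all => y /eqP ->.
rewrite fred_cons Ew; case: w Hw Ew aux => [|y w] // Hw Ew aux.
have sz v : rcons v (flip x) = y :: w -> size v = size w.
  by move/(congr1 size); rewrite size_rcons => -[].
rewrite fconsE; have [xy|/negPn/eqP Ey] := boolP (compat x y).
  case: (fred_rcons x Hw) => [->|[v Ev ->] E]; first exact: aux.
  by have := sz v (esym Ev); rewrite -E /= => /eqP; rewrite eqn_leq ltnNge leqnSn.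
case: (fred_rcons x Hw) => [-> E|[v Ev ->] E].
  by have := congr1 size E; rewrite size_rcons => /eqP; rewrite eqn_leq [_ <= size w]ltnNge leqnSn andbF.
by apply: (aux (flip x)) => //; rewrite -E -Ey in Ev *; rewrite rcons_cons -Ev.
Qed.

(** * The quotient that kills one letter *)

Section KillLetter.
Variable m : nat.

Definition kill (u : freegrp) : freegrp :=
  wval (fun k => if k == m then 1 else tgen k) (val u).

Lemma killM : {morph kill : x y / x * y}.
Proof. by move=> x y; rewrite /kill -wval_cat -[RHS]wval_fred. Qed.

Lemma kill_tgen k : kill (tgen k) = if k == m then 1 else tgen k.
Proof. by rewrite /kill /= mulg1. Qed.

Lemma kill_centralizer u : tgen m ^ u = tgen m -> kill u = 1.
Proof.
move=> E; have {}E : tgen m * u = u * tgen m by rewrite conjgC E.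
have Hu : sorted compat (val u) by apply/freducedP/eqP/(valP u).
have : all (fun x => x.1 == m) (val u).
  apply: (@centralizer_word _ (m, false)) => //.
  by rewrite -cats1; exact: (congr1 val E).
rewrite /kill; elim: (val u) => [|[k b] w IH] //= /andP[/= km /IH ->].
by rewrite /lval /= km mulg1; case: b; rewrite ?invg1.
Qed.

End KillLetter.

(** Reversal is inversion combined with inverting every generator, and the latter is a change of the
    family [d]. *)
Lemma wval_rev_trivial (w : fword) : fred (rev w) = [::] ->
  forall (G : groupType) (d : nat -> G), wval d w = 1.
Proof.
move=> E G d; apply: invg_inj; rewrite invg1 -wval_finv finvE -map_rev.
transitivity (wval (fun k => (d k)^-1) (rev w)); last by rewrite -wval_fred E.
elim: (rev w) => //= -[k b] v ->; congr (_ * _).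
by case: b; rewrite /lval /= ?invgK.
Qed.

(** The conclusion ranges over all groups with the braid relations, which expresses triviality in
    the braid group without constructing it. *)
Lemma braid_faithful m u : all (fun x => x.1 < m) u ->
    (forall x : nat -> freegrp, wval (@hurB freegrp) u x = x) ->
  forall (G : groupType) (d : nat -> G), braid_rel m d -> wval d u = 1.
Proof.
elim: m u => [|m IH] u Hu Fu; first by case: u Hu {Fu}.
have [bw [w [k [Hbw Hw km E]]]] := comb Hu.
have Eh := E _ _ (hur_braid_rel freegrp m.+1).
have fixb x : wval (@hurB freegrp) bw x m.+1 = x m.+1 by apply: hur_word_fix Hbw _.
have Ek : k = m.+1.
  (* With a nontrivial element only at the last position, a representative with [k] different from
     [m.+1] would bring the entry [1] there, and the other two factors can only conjugate it. The
     constant map serves as [f], since only the conjugacy is wanted. *)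
  apply/eqP/contraT => nk; pose x j : freegrp := if j == m.+1 then tgen 0 else 1.
  have := congr1 (fun y => y m.+1) (Fu x); rewrite Eh !bij_mulE fixb.
  have c1 : {morph (fun=> 1 : freegrp) : a b / (a * b : freegrp)} by move=> *; rewrite mulg1.
  set y := bfun (cval _ _ _) x.
  have [g [-> _] _] := @hur_Aword _ _ _ erefl c1 m.+1 w y Hw erefl.
  by rewrite /y hur_cw_last // /x (negPf nk) eqxx conj1g => /(congr1 val).
have k1 : kill m.+1 (tgen m.+1) = 1 by rewrite kill_tgen eqxx.
subst k; have [g [Eg fg] _] := @hur_Aword _ _ (kill m.+1) erefl (killM m.+1) m.+1 w tgen Hw k1.
have {}Eg : tgen m.+1 ^ g = tgen m.+1.
  rewrite -Eg -fixb -bij_mulE -[in RHS](Fu tgen) Eh.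
  by rewrite cvalmm mulg1.
(* The conjugator [g] centralizes the last generator, so it is trivial once that letter is killed;
   but its image spells [rev w] in the remaining free generators. *)
have w1 : fred (rev w) = [::].
  have : tofree (rev w) = tofree [::].
    rewrite -wval_tgen; transitivity (kill m.+1 g); last exact: kill_centralizer.
    rewrite fg.
    apply: (eq_wval_in (P := fun j => j < m.+1)); last by rewrite all_rev.
    by move=> j jm /=; rewrite kill_tgen ltn_eqF.
  by move/tofree_eqP.
have Eu (G : groupType) (d : nat -> G) : braid_rel m.+1 d -> wval d u = wval d bw.
  by move/E->; rewrite cvalmm (wval_rev_trivial w1) !mulg1.
move=> G d Hd; rewrite Eu //; apply: IH (braid_relW Hd) => // x.
by rewrite -(Eu _ _ (hur_braid_rel freegrp m.+1)) Fu.
Qed.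

(** * The free product of countably many groups of order two *)

(** The same reduction scheme as for free groups, with every letter its own inverse. *)
Definition ccons (x : nat) (acc : cword) : cword :=
  if acc is y :: acc' then if y == x then acc' else x :: acc else [:: x].
Arguments ccons : simpl never.

Lemma cred_cons x g : cred (x :: g) = ccons x (cred g).
Proof. by []. Qed.

Definition neqr (x y : nat) := y != x.

Lemma cconsE x y g : ccons x (y :: g) = if neqr x y then [:: x, y & g] else g.
Proof. by rewrite /ccons /neqr; case: eqP. Qed.

Lemma ccons_reduced x g : sorted neqr g -> sorted neqr (ccons x g).
Proof.
case: g => [|y g] // Hg; rewrite cconsE; case: ifP => [/= -> //|_].
exact: path_sorted Hg.
Qed.

Lemma cred_reduced g : sorted neqr (cred g).
Proof. by elim: g => [|x g IH] //; rewrite cred_cons ccons_reduced. Qed.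

Lemma reduced_cred g : sorted neqr g -> cred g = g.
Proof.
elim: g => [|x [|y g] IH] // Hg.
rewrite cred_cons IH ?(path_sorted Hg) // cconsE.
by case/andP: Hg => ->.
Qed.

Lemma cred_id g : cred (cred g) = cred g.
Proof. exact/reduced_cred/cred_reduced. Qed.

Lemma cconsK x g : sorted neqr g -> ccons x (ccons x g) = g.
Proof.
case: g => [|y g] Hg; first by rewrite [ccons x [::]]/ccons cconsE /neqr eqxx.
rewrite (cconsE x y); case: ifP => xy; first by rewrite cconsE /neqr eqxx.
move/negbFE/eqP: xy => <-; case: g Hg => [|z g] // Hg.
by rewrite cconsE; case/andP: Hg => ->.
Qed.

Lemma cred_cat g h : cred (g ++ h) = foldr ccons (cred h) g.
Proof. by elim: g => [|x g IH] //; rewrite cat_cons cred_cons IH. Qed.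

Lemma foldr_ccons_reduced g acc :
  sorted neqr acc -> sorted neqr (foldr ccons acc g).
Proof. by move=> Ha; elim: g => [|x g IH] //; apply: ccons_reduced. Qed.

Lemma cred_catl g h : cred (cred g ++ h) = cred (g ++ h).
Proof.
rewrite !cred_cat; have: sorted neqr (cred h) by apply: cred_reduced.
move: (cred h) => acc Ha; elim: g => [|x g IH] //.
rewrite cred_cons [RHS]/= -IH; case: (cred g) => [|y w] //.
rewrite cconsE; case: ifP => // /negbFE/eqP ->.
by rewrite /= cconsK // foldr_ccons_reduced.
Qed.

Lemma cred_catr g h : cred (g ++ cred h) = cred (g ++ h).
Proof. by rewrite !cred_cat cred_id. Qed.

Lemma cred_rev g : cred (rev g ++ g) = [::].
Proof.
elim: g => [|x g IH] //; rewrite rev_cons cat_rcons -cred_catr !cred_cons.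
by rewrite cconsK ?cred_reduced // cred_catr IH.
Qed.

Lemma all_cred (P : pred nat) g : all P g -> all P (cred g).
Proof.
elim: g => [|x g IH] // /andP[Px /IH]; rewrite cred_cons.
case: (cred g) => [|y h]; first by rewrite /= Px.
by rewrite cconsE; case: ifP => [_|_ /andP[]//]; rewrite /= Px.
Qed.

Lemma odd_size_cred g : odd (size (cred g)) = odd (size g).
Proof.
elim: g => [|x g IH] //; rewrite cred_cons /= -IH; case: (cred g) => [|y h] //.
by rewrite cconsE; case: ifP; rewrite //= negbK.
Qed.

Definition cgrp := {g : cword | cred g == g}.
HB.instance Definition _ := Choice.on cgrp.

Definition tocg (g : cword) : cgrp := exist _ (cred g) (introT eqP (cred_id g)).

Definition cg_mul (g h : cgrp) := tocg (val g ++ val h).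
Definition cg_inv (g : cgrp) := tocg (rev (val g)).

Lemma cg_mulA : associative cg_mul.
Proof. by move=> u v w; apply: val_inj; rewrite /= cred_catr cred_catl catA. Qed.
Lemma cg_mul1 : left_id (tocg [::]) cg_mul.
Proof. by move=> u; apply: val_inj; rewrite /=; apply/eqP/(valP u). Qed.
Lemma cg_mulr1 : right_id (tocg [::]) cg_mul.
Proof. by move=> u; apply: val_inj; rewrite /= cats0; apply/eqP/(valP u). Qed.
Lemma cg_mulV : left_inverse (tocg [::]) cg_inv cg_mul.
Proof. by move=> u; apply: val_inj; rewrite /= cred_catl cred_rev. Qed.
Lemma cg_mulrV : right_inverse (tocg [::]) cg_inv cg_mul.
Proof. by move=> u; apply: val_inj; rewrite /= cred_catr -{1}[val u]revK cred_rev. Qed.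

HB.instance Definition _ :=
  isGroup.Build cgrp cg_mulA cg_mul1 cg_mulr1 cg_mulV cg_mulrV.

Definition tau (k : nat) : cgrp := tocg [:: k].

Definition invol (G : groupType) (s : nat -> G) := forall k, s k * s k = 1.

Definition ceval (G : groupType) (s : nat -> G) (g : cword) : G :=
  foldr (fun k h => s k * h) 1 g.

Lemma ceval_cat (G : groupType) (s : nat -> G) g h :
  ceval s (g ++ h) = ceval s g * ceval s h.
Proof. by elim: g => [|k g IH]; rewrite ?mul1g //= IH mulgA. Qed.

Lemma ceval_flatten (G : groupType) (s : nat -> G) f g :
  ceval s (flatten (map f g)) = ceval (fun k => ceval s (f k)) g.
Proof. by elim: g => [|k g IH] //=; rewrite ceval_cat IH. Qed.

Lemma eq_ceval_in (G : groupType) (P : pred nat) (s s' : nat -> G) g :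
  (forall k, P k -> s k = s' k) -> all P g -> ceval s g = ceval s' g.
Proof. by move=> E; elim: g => [|k g IH] //= /andP[/E-> /IH->]. Qed.

Lemma invol_tau : invol tau.
Proof. by move=> k; apply: val_inj; rewrite /= /ccons /= eqxx. Qed.

Lemma involV (G : groupType) (s : nat -> G) k : invol s -> (s k)^-1 = s k.
Proof. by move=> Hs; apply/mulg1_eq/Hs. Qed.

Lemma ceval_cred (G : groupType) (s : nat -> G) g : invol s -> ceval s (cred g) = ceval s g.
Proof.
move=> Hs; elim: g => [|x g IH] //; rewrite cred_cons [RHS]/= -IH.
case: (cred g) => [|y h] //; rewrite cconsE.
by case: ifP => // /negbFE/eqP ->; rewrite /= mulgA Hs mul1g.
Qed.

Lemma wval_invol (G : groupType) (s : nat -> G) w :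
  invol s -> wval s w = ceval s (map fst w).
Proof.
move=> Hs; elim: w => [|[k b] w IH] //=; rewrite IH /lval /=.
by case: b; rewrite ?involV.
Qed.

Lemma ceval_tau g : ceval tau g = tocg g.
Proof.
elim: g => [|k g IH]; first exact: val_inj.
by rewrite /= IH; apply: val_inj; transitivity (cred ([:: k] ++ cred g)); rewrite // cred_catr.
Qed.

(** * Endomorphisms given by tables of words *)

Section HAct.
Variable G : groupType.
Implicit Types x y : nat -> G.

(** A sequence [x] stands for the homomorphism sending each t_k to [x k], and this is [phi] followed
    by it, in agreement with the convention of [hur]. *)
Definition hact (phi : fendo) x k : G := wval x (fimg phi k).

Lemma wval_fapp phi x w : wval x (fapp phi w) = wval (hact phi x) w.
Proof. by rewrite /fapp wval_fred wval_fsubst. Qed.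

Lemma fimg_fcomp phi psi k : fimg (fcomp phi psi) k = fapp psi (fimg phi k).
Proof.
rewrite /fimg /fcomp; have [kn|kn] := ltnP k (size phi); first by rewrite (nth_map [::]).
by rewrite !nth_default ?size_map.
Qed.

Lemma hact_fcomp phi psi x : hact (fcomp phi psi) x = hact phi (hact psi x).
Proof. by apply: funext => k; rewrite /hact fimg_fcomp wval_fapp. Qed.

End HAct.

Lemma fapp_hact phi w : fapp phi w = val (wval (hact phi tgen) w).
Proof. by rewrite -wval_fapp wval_tgen /= /fapp fred_id. Qed.

Lemma fapp_fcomp phi psi w : fapp (fcomp phi psi) w = fapp psi (fapp phi w).
Proof. by rewrite [LHS]fapp_hact hact_fcomp -wval_fapp -fapp_hact. Qed.

Lemma fcompA phi psi chi : fcomp phi (fcomp psi chi) = fcomp (fcomp phi psi) chi.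
Proof. by rewrite /fcomp -map_comp; apply: eq_map => w; apply: fapp_fcomp. Qed.

Section Endo.
Variable n : nat.

Lemma is_endoP phi :
  reflect (size phi = n /\ forall k, k < n -> is_fword n (fimg phi k)) (is_endo n phi).
Proof.
apply: (iffP andP) => [[/eqP Es /(all_nthP [::]) H]|[Es H]]; split=> //.
- by move=> k kn; apply: H; rewrite Es.
- exact/eqP.
- by apply/(all_nthP [::]) => k; rewrite Es; apply: H.
Qed.

Lemma fimg_default phi k : is_endo n phi -> n <= k -> fimg phi k = [::].
Proof. by case/is_endoP=> Es _ kn; rewrite /fimg nth_default ?Es. Qed.

Lemma fimg_letters phi k : is_endo n phi -> all (fun x => x.1 < n) (fimg phi k).
Proof.
move=> H; have [kn|kn] := ltnP k n; last by rewrite fimg_default.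
by case/is_endoP: H => _ /(_ k kn) /andP[].
Qed.

Lemma is_fwordE w : is_fword n w = sorted compat w && all (fun x => x.1 < n) w.
Proof. by congr (_ && _); apply/eqP/freducedP. Qed.

Lemma is_fword_fred w : all (fun x => x.1 < n) w -> is_fword n (fred w).
Proof. by move=> Hw; rewrite /is_fword fred_id eqxx (all_fred (P := fun k => k < n)). Qed.

Lemma fapp_is_fword phi w : is_endo n phi -> is_fword n (fapp phi w).
Proof.
move=> H; apply: is_fword_fred; rewrite -/(fsubst (fimg phi) w).
elim: w => [|[k b] w IH] //; rewrite /fsubst /= all_cat [all _ (flatten _)]IH andbT.
by case: b; rewrite ?(all_finv (fun k => k < n)) fimg_letters.
Qed.

Lemma is_endo_fcomp phi psi : is_endo n phi -> is_endo n psi -> is_endo n (fcomp phi psi).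
Proof.
case/is_endoP=> Es _ H; apply/is_endoP; rewrite size_map; split=> // k _.
by rewrite fimg_fcomp fapp_is_fword.
Qed.

Lemma fendo_eq phi psi : is_endo n phi -> is_endo n psi ->
  (forall k, k < n -> hact phi tgen k = hact psi tgen k) -> phi = psi.
Proof.
case/is_endoP=> Es H /is_endoP[Es' H'] E.
apply: (@eq_from_nth _ [::]) => [|k]; rewrite Es ?Es' // => kn.
have := E k kn; rewrite /hact !wval_tgen => /tofree_eqP.
by case/andP: (H k kn) => /eqP-> _; case/andP: (H' k kn) => /eqP-> _.
Qed.

Lemma eq_hact (G : groupType) (x y : nat -> G) phi k : is_endo n phi ->
  (forall j, j < n -> x j = y j) -> hact phi x k = hact phi y k.
Proof.
by move=> H E; apply: (eq_wval_in (P := fun j => j < n)) => //; apply: fimg_letters.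
Qed.

Lemma fimg_mk (f : nat -> fword) k : k < n -> fimg (map f (iota 0 n)) k = f k.
Proof. by move=> kn; rewrite /fimg (nth_map 0) ?size_iota // nth_iota. Qed.

Lemma fid_endo : is_endo n (fid n).
Proof.
apply/is_endoP; rewrite size_map size_iota; split=> // k kn.
by rewrite fimg_mk // is_fwordE /= kn.
Qed.

Lemma hact_fid (G : groupType) (x : nat -> G) k : k < n -> hact (fid n) x k = x k.
Proof. by move=> kn; rewrite /hact fimg_mk // wval1. Qed.

Lemma fcomp1 phi : is_endo n phi -> fcomp phi (fid n) = phi.
Proof.
move=> H; apply: fendo_eq => // [|k kn]; first exact: is_endo_fcomp fid_endo.
by rewrite hact_fcomp; apply: eq_hact => // j; apply: hact_fid.
Qed.

Lemma fcomp1l phi : is_endo n phi -> fcomp (fid n) phi = phi.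
Proof.
move=> H; apply: fendo_eq => // [|k kn]; first exact: is_endo_fcomp fid_endo _.
by rewrite hact_fcomp hact_fid.
Qed.

Lemma fapp_fid w : is_fword n w -> fapp (fid n) w = w.
Proof.
case/andP=> /eqP Ew Hw; rewrite fapp_hact -[RHS]Ew -[fred w]/(val (tofree w)) -wval_tgen.
by rewrite (eq_wval_in (P := fun k => k < n) _ Hw (d' := tgen)) // => k; apply: hact_fid.
Qed.

(** * The braid generators as automorphisms *)

Section Sigma.
Variable i : nat.
Hypothesis im : i.+1 < n.

Lemma sigma_endo : is_endo n (sigma n i).
Proof.
apply/is_endoP; rewrite size_map size_iota; split=> // k kn; rewrite fimg_mk //.
case: ifP => _; first by rewrite is_fwordE /= im.
case: ifP => _; last by rewrite is_fwordE /= kn.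
by rewrite is_fwordE /= /compat !xpair_eqE !neqSn im (ltnW im).
Qed.

Lemma sigma_inv_endo : is_endo n (sigma_inv n i).
Proof.
apply/is_endoP; rewrite size_map size_iota; split=> // k kn; rewrite fimg_mk //.
case: ifP => _; last first.
  by case: ifP => _; rewrite is_fwordE /= ?kn ?(ltnW im).
by rewrite is_fwordE /= /compat !xpair_eqE !neqSn im (ltnW im).
Qed.

Lemma hact_sigma (G : groupType) (x : nat -> G) k : k < n -> hact (sigma n i) x k = hur i x k.
Proof.
move=> kn; rewrite /hact fimg_mk // /hur; case: ifP => _; first by rewrite wval1.
by case: ifP => _; rewrite /= /lval /= ?mulg1.
Qed.

Lemma hact_sigma_inv (G : groupType) (x : nat -> G) k : k < n ->
  hact (sigma_inv n i) x k = hurV i x k.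
Proof.
move=> kn; rewrite /hact fimg_mk // /hurV; case: ifP => _.
  by rewrite /= /lval /= mulg1 conjgE invgK.
by case: ifP => _; rewrite wval1.
Qed.

Lemma eq_hur (G : groupType) (x y : nat -> G) : (forall j, j < n -> x j = y j) ->
  forall k, k < n -> hur i x k = hur i y k.
Proof. by move=> E k kn; rewrite /hur !E // ltnW. Qed.

Lemma eq_hurV (G : groupType) (x y : nat -> G) : (forall j, j < n -> x j = y j) ->
  forall k, k < n -> hurV i x k = hurV i y k.
Proof. by move=> E k kn; rewrite /hurV !E // ltnW. Qed.

Lemma sigmaK : fcomp (sigma n i) (sigma_inv n i) = fid n.
Proof.
have [s1 s2] := (sigma_endo, sigma_inv_endo).
apply: fendo_eq fid_endo _ => [|k kn]; first exact: is_endo_fcomp.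
rewrite hact_fcomp hact_sigma // hact_fid // -[RHS]/(tgen k) -[in RHS](hurVK i tgen).
by apply: eq_hur => // j; apply: hact_sigma_inv.
Qed.

Lemma sigmaVK : fcomp (sigma_inv n i) (sigma n i) = fid n.
Proof.
have [s1 s2] := (sigma_endo, sigma_inv_endo).
apply: fendo_eq fid_endo _ => [|k kn]; first exact: is_endo_fcomp.
rewrite hact_fcomp hact_sigma_inv // hact_fid // -[RHS]/(tgen k) -[in RHS](hurK i tgen).
by apply: eq_hurV => // j; apply: hact_sigma.
Qed.

End Sigma.

(** * Membership in B_n *)

Lemma wvalJw (G : groupType) (x : nat -> G) k v :
  wval x (finv v ++ (k, false) :: v) = x k ^ wval x v.
Proof. by rewrite wval_cat wval_finv. Qed.

Definition tword : fword := map (fun k => (k, false)) (iota 0 n).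

Lemma z1_fword : is_fword n (z1 n).
Proof.
rewrite /is_fword (all_finv (fun k => k < n)) all_map; apply/andP; split; last first.
  by apply/allP => k; rewrite mem_iota.
apply/eqP/freducedP; rewrite finv_reduced sorted_map.
by case: (n) => // m /=; elim: m 0 => //= m IH k; rewrite IH /compat xpair_eqE andbF.
Qed.

(** Only the block of positions [i] and [i.+1] changes, and its product is preserved because
    [b * a ^ b = a * b]. *)
Lemma wval_hur_tword (G : groupType) (x : nat -> G) i : i.+1 < n ->
  wval (hur i x) tword = wval x tword.
Proof.
move=> im; rewrite /tword.
have -> : n = i + (2 + (n - i.+2)) by rewrite addnA addn2 subnKC.
rewrite !iotaD !map_cat !wval_cat add0n; congr (_ * (_ * _)).
- apply: (eq_wval_in (P := fun k => k < i)); last first.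
    by rewrite all_map; apply/allP => k; rewrite mem_iota add0n.
  by move=> k ki; rewrite /hur !ltn_eqF // ltnW.
- by rewrite /= /lval /= /hur !eqxx !neqSn !mulg1 -conjgC.
- apply: (eq_wval_in (P := fun k => i.+1 < k)); last first.
    by rewrite all_map; apply/allP => k; rewrite mem_iota addn2 => /andP[].
  by move=> k ki; rewrite /hur !gtn_eqF // ltnW.
Qed.

Definition permuting (phi : fendo) :=
  exists (p : {perm 'I_n}) (w : seq fword),
    forall k : 'I_n,
      fimg phi k = fred (finv (nth [::] w k) ++ (nat_of_ord (p k), false) :: nth [::] w k).

Lemma nth_ordmap (f : 'I_n -> fword) (k : 'I_n) : nth [::] (map f (enum 'I_n)) k = f k.
Proof. by rewrite (nth_map k) ?size_enum_ord // nth_ord_enum. Qed.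

Lemma permuting_fcomp phi psi : permuting phi -> permuting psi -> permuting (fcomp phi psi).
Proof.
case=> p [w Hp] [q [v Hq]]; exists (p * q).
(* Applying [psi] to the conjugate of t_{p k} by [w_k] conjugates t_{q (p k)} first by [v_{p k}] and
   then by the image of [w_k]. *)
exists (map (fun k : 'I_n => nth [::] v (p k) ++ fapp psi (nth [::] w k)) (enum 'I_n)) => k.
rewrite nth_ordmap permM -[LHS]reduced_fred; last by rewrite fimg_fcomp fred_reduced.
apply/tofree_eqP; rewrite -!wval_tgen fimg_fcomp wval_fapp Hp wval_fred !wvalJw.
by rewrite /hact Hq wval_fred wvalJw wval_cat conjgM wval_fapp.
Qed.

Lemma inBn_endo phi : inBn n phi -> is_endo n phi.
Proof. by case=> -[]. Qed.

Lemma inBn_fcomp phi psi : inBn n phi -> inBn n psi -> inBn n (fcomp phi psi).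
Proof.
move=> [[e1 [phi' [e1' [E1 E1']]]] [z1 p1]] [[e2 [psi' [e2' [E2 E2']]]] [z2 p2]].
split; [split; [exact: is_endo_fcomp|] | split].
- exists (fcomp psi' phi'); split; first exact: is_endo_fcomp.
  split.
    by rewrite fcompA -[fcomp (fcomp phi psi) _]fcompA E2 fcomp1.
  by rewrite fcompA -[fcomp (fcomp psi' phi') _]fcompA E1' fcomp1.
- by rewrite fapp_fcomp z1 z2.
- exact: permuting_fcomp p1 p2.
Qed.

Lemma inBn_fid : inBn n (fid n).
Proof.
have e := fid_endo; split; [split=> //|split].
- by exists (fid n); rewrite !fcomp1.
- exact: fapp_fid z1_fword.
- exists 1, [::] => k; rewrite fimg_mk // nth_nil perm1 /=; reflexivity.
Qed.

Lemma inBn_hact phi k : inBn n phi -> k < n -> exists j, exists w,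
  forall (G : groupType) (x : nat -> G), hact phi x k = x j ^ wval x w.
Proof.
case=> _ [_ [p [w H]]] kn; exists (p (Ordinal kn)), (nth [::] w k) => G x.
by rewrite /hact (H (Ordinal kn)) wval_fred wvalJw.
Qed.

Lemma inBn_invol (G : groupType) (s : nat -> G) phi : inBn n phi -> invol s -> invol (hact phi s).
Proof.
move=> H Hs k; have [kn|kn] := ltnP k n.
  by have [j [w ->]] := inBn_hact H kn; rewrite -conjMg Hs conj1g.
(* Beyond the table the image is the empty word, whose value [1] also squares to [1]. *)
by rewrite /hact (fimg_default (inBn_endo H)) // mulg1.
Qed.

Lemma inBn_sigma_aux i : i.+1 < n -> inBn n (sigma n i) /\ inBn n (sigma_inv n i).
Proof.
move=> im; have [s1 s2] := (sigma_endo im, sigma_inv_endo im).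
have [K VK] := (sigmaK im, sigmaVK im).
have zs : fapp (sigma n i) (z1 n) = z1 n.
  case/andP: z1_fword => /eqP Ez _; rewrite fapp_hact -[RHS]Ez -[fred _]/(val (tofree _)).
  rewrite -wval_tgen; suff -> : wval (hact (sigma n i) tgen) (z1 n) = wval tgen (z1 n) by [].
  rewrite /z1 !wval_finv; congr _^-1; rewrite -/tword -[RHS](wval_hur_tword _ im).
  apply: (eq_wval_in (P := fun k => k < n)) => [k kn|]; first by rewrite hact_sigma.
  by rewrite all_map; apply/allP => k; rewrite mem_iota.
have pw (k : 'I_n) : tperm (Ordinal (ltnW im)) (Ordinal im) k =
    (if val k == i then i.+1 else if val k == i.+1 then i else val k) :> nat.
  case: tpermP => [->|->|/eqP k1 /eqP k2] /=; rewrite ?eqxx ?neqSn //.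
  by move: k1 k2; rewrite -!val_eqE /= => /negPf-> /negPf->.
split; split; [split=> // | split=> // | split=> // | split].
- by exists (sigma_inv n i).
- exists (tperm (Ordinal (ltnW im)) (Ordinal im)).
  exists (map (fun k : 'I_n => if val k == i.+1 then [:: (i.+1, false)] else [::]) (enum 'I_n)) => k.
  rewrite nth_ordmap pw fimg_mk //; have [->|_] := eqVneq (val k) i; first by rewrite !neqSn.
  by have [_|_] := eqVneq (val k) i.+1; rewrite //= /fcons /= !neqSn /= neqSn.
- by exists (sigma n i).
(* The inverse fixes [z1 n] because [sigma] does. *)
- by rewrite -[in RHS](fapp_fid z1_fword) -K fapp_fcomp zs.
- exists (tperm (Ordinal (ltnW im)) (Ordinal im)).
  exists (map (fun k : 'I_n => if val k == i then [:: (i, true)] else [::]) (enum 'I_n)) => k.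
  rewrite nth_ordmap pw fimg_mk //; have [_|_] := eqVneq (val k) i.
    by rewrite /= /fcons /= !neqSn /= neqSn.
  by case: eqP.
Qed.

Lemma inBn_sigma i : i.+1 < n -> inBn n (sigma n i).
Proof. by case/inBn_sigma_aux. Qed.

Lemma inBn_sigma_inv i : i.+1 < n -> inBn n (sigma_inv n i).
Proof. by case/inBn_sigma_aux. Qed.

End Endo.

(** * The semidirect product *)

Lemma odd_size_fred w : odd (size (fred w)) = odd (size w).
Proof.
elim: w => [|x w IH] //; rewrite fred_cons /= -IH; case: (fred w) => [|y v] //.
by rewrite fconsE; case: ifP; rewrite //= negbK.
Qed.

(** A conjugate of a generator has odd length and reduction preserves parity. Hence the even
    subgroup is invariant under B_n. *)
Lemma odd_fimg n phi k : inBn n phi -> k < n -> odd (size (fimg phi k)).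
Proof.
case=> _ [_ [p [w H]]] kn; rewrite (H (Ordinal kn)) odd_size_fred size_cat size_finv /=.
by rewrite addnS addnn /= odd_double.
Qed.

Lemma odd_cact n phi g : inBn n phi -> all (fun k => k < n) g ->
  odd (size (cact phi g)) = odd (size g).
Proof.
move=> H; rewrite odd_size_cred; elim: g => [|k g IH] //= /andP[kn /IH {}IH].
by rewrite size_cat oddD IH size_map (odd_fimg H).
Qed.

Lemma cact_letters n phi g : is_endo n phi -> all (fun k => k < n) (cact phi g).
Proof.
move=> H; apply: all_cred; elim: g => [|k g IH] //=.
by rewrite all_cat IH andbT all_map; apply: fimg_letters.
Qed.

Lemma tocg_cact phi g : tocg (cact phi g) = ceval (hact phi tau) g.
Proof.
rewrite -ceval_tau (ceval_cred _ invol_tau) ceval_flatten.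
elim: g => [|k g IH] //=; rewrite IH; congr (_ * _).
by rewrite /hact (wval_invol _ invol_tau).
Qed.

Lemma tocg_sdmul x y : tocg (sdmul x y).2 = ceval (hact y.1 tau) x.2 * tocg y.2.
Proof. by rewrite /= -tocg_cact -!ceval_tau (ceval_cred _ invol_tau) ceval_cat. Qed.

Lemma ceval_cact (G : groupType) (s : nat -> G) phi g : invol s ->
  ceval s (cact phi g) = ceval (hact phi s) g.
Proof.
move=> Hs; rewrite (ceval_cred _ Hs) ceval_flatten.
elim: g => [|k g IH] //=; rewrite IH; congr (_ * _).
by rewrite /hact (wval_invol _ Hs).
Qed.

(** Membership of [z.1] in B_n makes [hact z.1 tau] a family of involutions, so [z.1] respects the
    cancellations made when multiplying [x] by [y]. *)
Lemma sdmulA n x y z : inBn n z.1 -> sdmul x (sdmul y z) = sdmul (sdmul x y) z.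
Proof.
move=> Hz; have Hs := inBn_invol Hz invol_tau.
have E : tocg (sdmul x (sdmul y z)).2 = tocg (sdmul (sdmul x y) z).2.
  rewrite !tocg_sdmul /= hact_fcomp (ceval_cred _ Hs) ceval_cat (ceval_cact _ _ Hs).
  by rewrite mulgA.
have {}E := congr1 val E; rewrite /= !cred_id in E.
by apply/pair_equal_spec; split=> //; rewrite /= fcompA.
Qed.

Lemma sdmul1l n x : inBnPhi n x -> sdmul (sdone n) x = x.
Proof.
by case: x => phi g [/= H [/andP[/= /eqP Eg _] _]]; rewrite /sdmul /= Eg (fcomp1l (inBn_endo H)).
Qed.

Lemma inBnPhi_mul n x y : inBnPhi n x -> inBnPhi n y -> inBnPhi n (sdmul x y).
Proof.
case: x y => phi g [psi h] [/= H [/andP[_ Hg] eg]] [/= H' [/andP[_ Hh] eh]].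
split; [exact: inBn_fcomp | split].
  rewrite /is_cword cred_id eqxx; apply: all_cred.
  by rewrite all_cat Hh (cact_letters _ (inBn_endo H')).
by rewrite odd_size_cred size_cat oddD (odd_cact H') // (negPf eg) (negPf eh).
Qed.

Lemma inBnPhi_one n : inBnPhi n (sdone n).
Proof. by split; [exact: inBn_fid|]. Qed.

Lemma sd_eq n x y : inBnPhi n x -> inBnPhi n y ->
    (forall k, k < n -> hact x.1 tgen k = hact y.1 tgen k) ->
  tocg x.2 = tocg y.2 -> x = y.
Proof.
case: x y => phi g [psi h] [/= H [/andP[/eqP Eg _] _]] [/= H' [/andP[/eqP Eh _] _]] E1 E2.
congr pair; last by have := congr1 val E2; rewrite /= Eg Eh.
exact: fendo_eq (inBn_endo H) (inBn_endo H') E1.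
Qed.

(** * The evaluation map and the defining relations *)

Section Aeval.
Variable N : nat.
Local Notation n := N.+2.

Definition sdlet (x : nat * bool) := if x.2 then dimg_inv n x.1 else dimg n x.1.

Lemma aeval_cons x u : aeval n (x :: u) = sdmul (sdlet x) (aeval n u).
Proof. by []. Qed.

(* The retraction of Art<D_n> onto its subgroup generated by d_1, ..., d_{n-1},
   which sends d_n to d_{n-1}. *)
Definition retr (u : aword) : aword := map (fun x => (minn x.1 N, x.2)) u.

(** The C_2^{*n}-component of the image of a letter. The inverse of the last generator gets the
    reversed word itself, because [sigma n N] fixes the product of [tau N.+1] and [tau N]. *)
Definition dsec (x : nat * bool) : cword :=
  if x.1 < N.+1 then [::] else if x.2 then [:: N; N.+1] else [:: N.+1; N].

Lemma sdlet1 x : (sdlet x).1 = if x.2 then sigma_inv n (minn x.1 N) else sigma n (minn x.1 N).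
Proof.
case: x => i b; rewrite /sdlet /dimg /dimg_inv /=; have [iN|iN] := ltnP i N.+1.
  by rewrite (minn_idPl _) //; case: b.
by rewrite (minn_idPr (ltnW iN)); case: b.
Qed.

Lemma sdlet2 x : (sdlet x).2 = dsec x.
Proof.
case: x => i b; rewrite /sdlet /dimg /dimg_inv /dsec /=.
have [iN|iN] := ltnP i N.+1; case: b => //=.
have E1 : fimg (sigma_inv n N) N = [:: (N, false); (N.+1, false); (N, true)].
  by rewrite fimg_mk // eqxx.
have E2 : fimg (sigma_inv n N) N.+1 = [:: (N, false)] by rewrite fimg_mk // neqSn eqxx.
transitivity (cred (map fst (fimg (sigma_inv n N) N) ++
  map fst (fimg (sigma_inv n N) N.+1) ++ [::])) => //.
by rewrite E1 E2 /= /ccons /= eqxx neqSn.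
Qed.

Lemma minnN i : (minn i N).+1 < n.
Proof. by rewrite !ltnS geq_minr. Qed.

Lemma inBnPhi_sdlet x : inBnPhi n (sdlet x).
Proof.
have H : inBn n (sdlet x).1.
  by rewrite sdlet1; case: x.2; [apply: inBn_sigma_inv | apply: inBn_sigma]; apply: minnN.
rewrite /inBnPhi sdlet2 /dsec; split=> //.
case: ifP => // _; case: x.2; rewrite /is_cword /= /ccons /= ?ltnSn ?neqSn eqxx ?andbT //=.
Qed.

Lemma aeval_inBnPhi u : inBnPhi n (aeval n u).
Proof.
elim: u => [|x u IH]; first exact: inBnPhi_one.
by rewrite aeval_cons; apply: inBnPhi_mul IH; apply: inBnPhi_sdlet.
Qed.

Lemma aeval_cat u v : aeval n (u ++ v) = sdmul (aeval n u) (aeval n v).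
Proof.
have Hv := aeval_inBnPhi v.
elim: u => [|x u IH]; first by rewrite sdmul1l.
by rewrite cat_cons !aeval_cons IH (sdmulA _ _ Hv.1).
Qed.

(** The last two generators have the same automorphism part, so this part sees only the retracted
    word. *)
Lemma hact_aeval (G : groupType) (x : nat -> G) u k : k < n ->
  hact (aeval n u).1 x k = wval (@hurB G) (retr u) x k.
Proof.
elim: u k => [|[i b] u IH] k kn; first exact: hact_fid.
rewrite aeval_cons /= hact_fcomp sdlet1 /= /lval /=; have Hm := minnN i; case: b.
  by rewrite hact_sigma_inv //; apply: (eq_hurV (n := n)).
by rewrite hact_sigma //; apply: (eq_hur (n := n)).
Qed.

Lemma aeval2_cons x u : tocg (aeval n (x :: u)).2 =
  ceval (wval (@hurB cgrp) (retr u) tau) (dsec x) * tocg (aeval n u).2.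
Proof.
rewrite aeval_cons tocg_sdmul sdlet2; congr (_ * _).
apply: (eq_ceval_in (P := fun k => k < n)); first by move=> k; apply: hact_aeval.
by rewrite /dsec; case: ifP => // _; case: x.2; rewrite /= !ltnS leqnSn leqnn.
Qed.

Lemma aeval_eq u v : wval (@hurB freegrp) (retr u) = wval (@hurB freegrp) (retr v) ->
  tocg (aeval n u).2 = tocg (aeval n v).2 -> aeval n u = aeval n v.
Proof.
move=> E; apply: (sd_eq (n := n)); try exact: aeval_inBnPhi.
by move=> k kn; rewrite !hact_aeval // E.
Qed.

Lemma aeval2_braid u : all (fun x => x.1 < N.+1) u -> tocg (aeval n u).2 = 1.
Proof.
elim: u => [|x u IH]; first by move=> _; apply: val_inj.
by case/andP=> xN /IH; rewrite aeval2_cons /dsec xN => ->; rewrite mulg1.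
Qed.

Lemma retr_id u : all (fun x => x.1 < N.+1) u -> retr u = u.
Proof.
elim: u => [|[i b] u IH] //= /andP[/= iN /IH ->].
by rewrite (minn_idPl _).
Qed.

Lemma involVtau k : (tau k)^-1 = tau k.
Proof. exact: involV invol_tau. Qed.

Lemma tauK k g : tau k * (tau k * g) = g.
Proof. by rewrite mulgA invol_tau mul1g. Qed.

Lemma aeval_cancel i b : aeval n [:: (i, b); (i, ~~ b)] = aeval n [::].
Proof.
apply: aeval_eq; first by case: b; rewrite /= /lval /= !mulg1 ?mulgV ?mulVg.
rewrite !aeval2_cons [aeval n [::]]/= /dsec /=; have [iN|iN] := ltnP i N.+1; first by rewrite !mul1g.
rewrite (minn_idPr (ltnW iN)).
by case: b; rewrite /= /lval /= /hur /hurV !eqxx !neqSn !mulg1 ?conjgE ?involVtau -?mulgA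
   ?(tauK, invol_tau, mulg1, mul1g).
Qed.

Local Notation d_ i := (i, false).

Lemma aeval_braid i : i < N -> aeval n [:: d_ i; d_ i.+1; d_ i] = aeval n [:: d_ i.+1; d_ i; d_ i.+1].
Proof.
move=> iN; have [h1 h2] : i < N.+1 /\ i.+1 < N.+1 by split; rewrite ltnS // ltnW.
apply: aeval_eq; last by rewrite !aeval2_braid /= ?h1 ?h2.
by rewrite !retr_id /= ?h1 ?h2 // /lval /= !mulg1 !mulgA; apply: hur_braid.
Qed.

Lemma aeval_commute i j : i.+1 < j <= N -> aeval n [:: d_ i; d_ j] = aeval n [:: d_ j; d_ i].
Proof.
case/andP=> ij jN; have iN : i <= N by rewrite (leq_trans _ jN) // ltnW // ltnW.
apply: aeval_eq; last by rewrite !aeval2_braid //= !ltnS jN iN.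
by rewrite !retr_id /= ?ltnS ?iN ?jN // /lval /= !mulg1; apply: hur_commute.
Qed.

Lemma minSN : minn N.+1 N = N. Proof. exact/minn_idPr/leqnSn. Qed.

Lemma aeval_comm_bc : aeval n [:: d_ N; d_ N.+1] = aeval n [:: d_ N.+1; d_ N].
Proof.
apply: aeval_eq; first by rewrite /= minSN minnn.
rewrite !aeval2_cons [aeval n [::]]/= /dsec /= ltnn ltnSn minSN minnn /=.
rewrite /lval /= /hur !eqxx !neqSn !mulg1 ?mul1g conjgE ?involVtau.
by rewrite -?mulgA ?(tauK, invol_tau, mulg1, mul1g).
Qed.

Lemma aeval_comm_ic i : i.+1 < N -> aeval n [:: d_ i; d_ N.+1] = aeval n [:: d_ N.+1; d_ i].
Proof.
move=> iN; have iN' : i < N.+1 by rewrite ltnW // ltnW.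
apply: aeval_eq.
  by rewrite /= minSN (minn_idPl (ltnW (ltnW iN))) /lval /= !mulg1; apply: hur_commute.
rewrite !aeval2_cons [aeval n [::]]/= /dsec /= ltnn iN' (minn_idPl (ltnW (ltnW iN))) /=.
rewrite /lval /= /hur !gtn_eqF ?mulg1 ?mul1g //; first by rewrite ltnW.
all: by rewrite ltnW // ltnW.
Qed.

Lemma aeval_braid_ac i : i.+1 = N ->
  aeval n [:: d_ i; d_ N.+1; d_ i] = aeval n [:: d_ N.+1; d_ i; d_ N.+1].
Proof.
move=> E; have Em : minn i N = i by apply/minn_idPl; rewrite -E.
have iN : i < N.+1 by rewrite -E ltnW.
apply: aeval_eq.
  by rewrite /= minSN Em /lval /= !mulg1 -E !mulgA; apply: hur_braid.
rewrite !aeval2_cons [aeval n [::]]/= /dsec /= ltnn iN minSN Em /= -E.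
rewrite -[tocg [::]]/(1 : cgrp) /hur ?(eqxx, eqSS, neqSn) !mulg1 ?mul1g !conjgE.
by rewrite ?involVtau ?invgM ?involVtau -?mulgA ?(tauK, invol_tau, mulg1, mul1g).
Qed.

End Aeval.

Lemma adjD_sym n i j : adjD n i j = adjD n j i.
Proof. by rewrite /adjD [(j.+1 == i) || _]orbC andbAC [X in (3 <= n) && X]orbC. Qed.

Lemma adjD_last N i : i < N.+1 -> adjD N.+2 i N.+1 = (i.+1 == N).
Proof.
move=> iN; rewrite /adjD /= ltnn !andbF /= subn1 /= eqxx andbT.
rewrite [i == N.+1]ltn_eqF // andbF orbF.
by case: N iN => //= N iN; rewrite !subSS subn0 eqSS.
Qed.

Lemma adjD_braid N i j : i < N.+1 -> j < N.+1 ->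
  adjD N.+2 i j = (i.+1 == j) || (j.+1 == i).
Proof.
move=> iN jN; rewrite /adjD /= iN jN !andbT subn1 /=.
by rewrite [i == N.+1]ltn_eqF // [j == N.+1]ltn_eqF // !andbF orbF.
Qed.

Lemma art_rel_aeval N l r : art_rel N.+2 l r -> aeval N.+2 l = aeval N.+2 r.
Proof.
(* The relations and the adjacency are symmetric, so only [i < j] has to be treated. *)
have sym (P : nat -> nat -> Prop) : (forall i j, P i j -> P j i) ->
    (forall i j, i < j -> j < N.+2 -> P i j) ->
    forall i j, i < N.+2 -> j < N.+2 -> i != j -> P i j.
  by move=> Ps H i j iN jN; rewrite neq_ltn => /orP[ij|ji]; [|apply: Ps]; apply: H.
case=> [[i [b [iN [-> ->]]]]|[[i [j [[iN jN nij adj] [-> ->]]]]|[i [j [[iN jN nij adj] [-> ->]]]]]].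
- exact: aeval_cancel.
- move: i j iN jN nij adj; apply: sym => [i j H|i j ij].
    by rewrite adjD_sym => /H.
  rewrite ltnS leq_eqVlt => /orP[/eqP Ej|jN].
    by subst j; rewrite adjD_last // => /eqP; apply: aeval_braid_ac.
  rewrite adjD_braid // ?(ltn_trans ij) // [j.+1 == i]gtn_eqF ?orbF; last by rewrite ltnW.
  by move/eqP=> Ej; rewrite -Ej in jN *; apply: aeval_braid.
- move: i j iN jN nij adj; apply: sym => [i j H|i j ij].
    by rewrite adjD_sym => /H.
  rewrite ltnS leq_eqVlt => /orP[/eqP Ej|jN].
    subst j; rewrite adjD_last // => nE; move: ij; rewrite ltnS leq_eqVlt => /orP[/eqP ->|iN].
      exact: aeval_comm_bc.
    by apply: aeval_comm_ic; rewrite ltn_neqAle nE.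
  rewrite adjD_braid // ?(ltn_trans ij) // [j.+1 == i]gtn_eqF ?orbF; last by rewrite ltnW.
  by move=> nE; apply: aeval_commute; rewrite ltn_neqAle nE ij.
Qed.

Lemma art_eq_aeval N u v : art_eq N.+2 u v -> aeval N.+2 u = aeval N.+2 v.
Proof.
elim=> [x y [a [b [l [r [-> -> /art_rel_aeval E]]]]]|x|x y _ ->|x y z _ -> _ ->] //.
by rewrite !aeval_cat E.
Qed.

(** * The Artin group as a quotient type *)

Section ArtinGroup.
Variable n : nat.

Lemma art_eq_cat a u v b : art_eq n u v -> art_eq n (a ++ u ++ b) (a ++ v ++ b).
Proof.
elim=> [x y [a' [b' [l [r [-> -> H]]]]]|x|x y _ IH|x y z _ IH1 _ IH2].
- apply: rst_step; exists (a ++ a'), (b' ++ b), l, r; split=> //.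
    by rewrite -!catA.
  by rewrite -!catA.
- exact: rst_refl.
- exact: rst_sym.
- exact: rst_trans IH1 IH2.
Qed.

Lemma art_eq_finv u : is_aword n u -> art_eq n (u ++ finv u) [::].
Proof.
elim: u => [|x u IH] /=; first by move=> _; apply: rst_refl.
case/andP=> xn /IH H; apply: (rst_trans _ _ _ ([:: x] ++ [::] ++ [:: flip x])).
  by rewrite finv_cons -cats1 catA -cat1s; apply: art_eq_cat.
apply: rst_step; exists [::], [::], [:: x; flip x], [::]; split=> //.
by left; exists x.1, x.2; rewrite /flip -surjective_pairing.
Qed.

(* Letters outside the alphabet are read as trivial, so that every word has
   an inverse in the quotient. *)
Definition alph (u : aword) : aword := [seq x <- u | x.1 < n].

Lemma alph_cat u v : alph (u ++ v) = alph u ++ alph v.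
Proof. exact: filter_cat. Qed.

Lemma alph_id u : is_aword n u -> alph u = u.
Proof. by move=> H; apply/all_filterP. Qed.

Lemma alph_aword u : is_aword n (alph u).
Proof. exact: filter_all. Qed.

Lemma alph_finv u : alph (finv u) = finv (alph u).
Proof. by rewrite /alph !finvE filter_rev filter_map. Qed.

Definition arteqb (u v : aword) : bool := `[< art_eq n (alph u) (alph v) >].

Lemma arteqb_refl : reflexive arteqb.
Proof. by move=> u; apply/asboolP/rst_refl. Qed.
Lemma arteqb_sym : symmetric arteqb.
Proof. by move=> u v; apply/asboolP/asboolP; apply: rst_sym. Qed.
Lemma arteqb_trans : transitive arteqb.
Proof. by move=> v u w /asboolP H1 /asboolP H2; apply/asboolP/(rst_trans _ _ _ _ _ H1 H2). Qed.

Canonical arteqb_equiv := EquivRel arteqb arteqb_refl arteqb_sym arteqb_trans.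

Definition artgrp := {eq_quot arteqb}%qT.
HB.instance Definition _ := Choice.on artgrp.
HB.instance Definition _ := EqQuotient.on artgrp.

Definition artclass (u : aword) : artgrp := (\pi_artgrp u)%qT.

Lemma artclassP u v : artclass u = artclass v <-> art_eq n (alph u) (alph v).
Proof.
split=> [/eqP|H]; first by rewrite /artclass eqmodE => /asboolP.
by apply/eqP; rewrite /artclass eqmodE; apply/asboolP.
Qed.

(* [repr] alone denotes the choice function of finite groups. *)
Local Notation qrepr := generic_quotient.repr.

Definition art_mul (x y : artgrp) := artclass (qrepr x ++ qrepr y).
Definition art_inv (x : artgrp) := artclass (finv (qrepr x)).

Lemma reprclass x : artclass (qrepr x) = x.
Proof. exact: reprK. Qed.

Lemma artclass_cat u v : art_mul (artclass u) (artclass v) = artclass (u ++ v).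
Proof.
apply/artclassP; rewrite !alph_cat.
have /artclassP Hu := reprclass (artclass u); have /artclassP Hv := reprclass (artclass v).
apply: (rst_trans _ _ _ (alph u ++ alph (qrepr (artclass v)))).
  exact: (art_eq_cat [::]).
by have := art_eq_cat (alph u) [::] Hv; rewrite !cats0.
Qed.

Lemma art_mulA : associative art_mul.
Proof.
move=> x y z; rewrite -[x]reprclass -[y]reprclass -[z]reprclass.
by rewrite !artclass_cat catA.
Qed.
Lemma art_mul1 : left_id (artclass [::]) art_mul.
Proof. by move=> x; rewrite -[x]reprclass artclass_cat. Qed.
Lemma art_mulr1 : right_id (artclass [::]) art_mul.
Proof. by move=> x; rewrite -[x]reprclass artclass_cat cats0. Qed.
Lemma art_mulrV : right_inverse (artclass [::]) art_inv art_mul.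
Proof.
move=> x; rewrite -[x in art_mul x _]reprclass artclass_cat; apply/artclassP.
by rewrite alph_cat alph_finv; apply/art_eq_finv/alph_aword.
Qed.
Lemma art_mulV : left_inverse (artclass [::]) art_inv art_mul.
Proof.
move=> x; rewrite -[x in art_mul _ x]reprclass artclass_cat; apply/artclassP.
rewrite alph_cat alph_finv -{2}[alph _]finvK; apply: art_eq_finv.
by rewrite /is_aword (all_finv (fun k => k < n)); apply: alph_aword.
Qed.

HB.instance Definition _ :=
  isGroup.Build artgrp art_mulA art_mul1 art_mulr1 art_mulV art_mulrV.

Definition dgen (k : nat) : artgrp := artclass [:: (k, false)].

Lemma wval_dgen u : wval dgen u = artclass u.
Proof.
elim: u => [|[k b] u IH] //.
rewrite wval_cons IH -[_ :: u]cat1s -artclass_cat; congr (_ * _).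
rewrite /lval /=; case: b => //=; apply: mulg1_eq.
rewrite [LHS]artclass_cat; apply/artclassP.
by rewrite alph_cat -[[:: (k, true)]]/(finv [:: (k, false)]) alph_finv; apply/art_eq_finv/alph_aword.
Qed.

Lemma dgen_rel l r : is_aword n l -> is_aword n r -> art_rel n l r -> wval dgen l = wval dgen r.
Proof.
move=> Hl Hr H; rewrite !wval_dgen; apply/artclassP; rewrite !alph_id //.
by apply: rst_step; exists [::], [::], l, r; split=> //; rewrite cats0.
Qed.

End ArtinGroup.

(** * The even subgroup inside a group satisfying the D_n relations *)

(** The D_n relations arranged as braid relations among [d 0] to [d N], together with those of the
    twin [d N.+1] of [d N]. *)
Definition artD_rel (G : groupType) N (d : nat -> G) :=
  [/\ braid_rel N.+1 d, commute (d N) (d N.+1),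
      forall i, i.+1 < N -> commute (d i) (d N.+1)
    & forall i, i.+1 = N -> d i * d N.+1 * d i = d N.+1 * d i * d N.+1].

Lemma dgen_artD N : artD_rel N (@dgen N.+2).
Proof.
have comm i j : i < N.+2 -> j < N.+2 -> i != j -> ~~ adjD N.+2 i j ->
    commute (@dgen N.+2 i) (@dgen N.+2 j).
  move=> iN jN nij adj; have := @dgen_rel N.+2 [:: (i, false); (j, false)] [:: (j, false); (i, false)].
  rewrite /= /lval /= !mulg1 iN jN; apply=> //.
  by right; right; exists i, j.
have braid i j : i < N.+2 -> j < N.+2 -> i != j -> adjD N.+2 i j ->
    @dgen N.+2 i * dgen _ j * dgen _ i = dgen _ j * dgen _ i * dgen _ j.
  move=> iN jN nij adj.
  have := @dgen_rel N.+2 [:: (i, false); (j, false); (i, false)] [:: (j, false); (i, false); (j, false)].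
  rewrite /= /lval /= !mulg1 iN jN -!mulgA; apply=> //.
  by right; left; exists i, j.
split; first split.
- move=> i iN; have iN' := ltnW iN.
  by apply: braid; rewrite ?adjD_braid ?eqxx ?neqSn // ?(leqW iN) ?(leqW iN').
- move=> i j ij jN; have iN : i < N.+1 by apply: ltn_trans jN; apply: ltnW.
  apply: comm; rewrite ?adjD_braid // ?(leqW iN) ?(leqW jN) //; first by rewrite ltn_eqF // ltnW.
  by rewrite ltn_eqF // gtn_eqF // ltnW // ltnW.
- by apply: comm; rewrite ?adjD_last ?neqSn.
- move=> i iN; have iN' : i < N.+1 by rewrite ltnW // ltnW.
  by apply: comm; rewrite ?adjD_last // ?(leqW iN') // ltn_eqF.
- move=> i iN; have iN' : i < N.+1 by rewrite -iN ltnW.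
  by apply: braid; rewrite ?adjD_last // ?(leqW iN') ?iN // ltn_eqF.
Qed.

(** * Identities at the fork of the diagram *)

Section ForkIdentities.
Variables (G : groupType) (a b c : G).
Hypotheses (ab : a * b * a = b * a * b) (ac : a * c * a = c * a * c) (bc : commute b c).

(** With [a], [b], [c] the generators [N.-1], [N], [N.+1], the element [b^-1 * c] is [Y N] and its
    conjugate by [a^-1] is [Y N.-1]. This starts the induction of [Y_conj_upper]. *)
Lemma fork_conj1 : (b^-1 * c) ^ a = b^-1 * c * ((b^-1 * c) ^ a^-1)^-1 * (b^-1 * c).
Proof.
have cac : c * a * c^-1 = a^-1 * c * a.
  by apply: (mulgI a); apply: (mulIg c); rewrite !mulgA mulgV mul1g mulgVK -ac.
have bab : b * a^-1 * b^-1 = a^-1 * b^-1 * a.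
  by apply: (mulgI (b * a)); apply: (mulIg b); rewrite !mulgA mulgVK mulgK mulgV mul1g -ab mulgK.
have cb : c * b^-1 = b^-1 * c by rewrite -(commuteV (commute_sym bc)).
rewrite !conjgE !invgM !invgK !mulgA.
have -> : b^-1 * c * a * c^-1 * b * a^-1 * b^-1 * c
   = b^-1 * (c * a * c^-1) * (b * a^-1 * b^-1) * c by rewrite !mulgA.
rewrite cac bab !mulgA mulgK.
have -> : b^-1 * a^-1 * c * b^-1 * a * c = b^-1 * a^-1 * (c * b^-1) * a * c by rewrite !mulgA.
rewrite cb !mulgA (braid_inv ab).
have -> : a^-1 * b^-1 * a^-1 * c * a * c = a^-1 * b^-1 * a^-1 * (c * a * c) by rewrite !mulgA.
by rewrite -ac !mulgA mulgVK.
Qed.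

(** The effect of conjugating [Y N.-1] by [d N], which starts the induction of [Y_conj_braid]. *)
Lemma fork_conj2 : ((b^-1 * c) ^ a^-1) ^ b = b^-1 * c * (b^-1 * c) ^ a^-1.
Proof.
have bab : a^-1 * b = b * a * b^-1 * a^-1.
  by apply: (mulgI a); rewrite mulVKg !mulgA ab !mulgK.
have cb : c * b^-1 = b^-1 * c by rewrite -(commuteV (commute_sym bc)).
rewrite !conjgE !invgK -!mulgA; congr (_ * _); rewrite bab !mulgA.
have -> : a * b^-1 * c * b * a * b^-1 * a^-1 = a * b^-1 * (c * b) * a * b^-1 * a^-1 by rewrite !mulgA.
rewrite -bc !mulgA mulgVK ac.
have -> : c * a * c * b^-1 * a^-1 = c * a * (c * b^-1) * a^-1 by rewrite !mulgA.
by rewrite cb !mulgA.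
Qed.

End ForkIdentities.

Lemma down_ind (N : nat) (P : nat -> Prop) :
  P N -> (forall k, k < N -> P k.+1 -> P k) -> forall k, k <= N -> P k.
Proof.
move=> P0 PS k kN; rewrite -(subKn kN); elim: (N - k) (leq_subr k N) => [|j IH] jN.
  by rewrite subn0.
have E : (N - j.+1).+1 = N - j by rewrite subnSK.
by apply: PS; rewrite E ?leq_subr //; apply/IH/ltnW.
Qed.

(** * The elements Y_k and the homomorphism Theta *)

Section EvenPart.
Variable N : nat.
Local Notation n := N.+2.

Definition Pword k : aword := [seq (i, false) | i <- iota k (N - k)].
(** Words for the elements Y_k with base letter [N.+1]; as words they can be evaluated both in the
    Artin group and by [aeval]. *)
Definition Yword k : aword :=
  if k == N.+1 then [::] else Pword k ++ [:: (N, true); (N.+1, false)] ++ finv (Pword k).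

Lemma Yword_letters k j : k <= N.+1 -> j \in Yword k -> (k <= j.1 < N) || (N <= j.1 <= N.+1).
Proof.
have HP x : k <= N.+1 -> x \in Pword k -> k <= x.1 < N.
  move=> kN /mapP[i]; rewrite mem_iota => /andP[ki iN] -> /=; rewrite ki.
  by have [/subnKC <- //|/ltnW kN'] := leqP k N; move: iN; rewrite (eqP kN') addn0 ltnNge ki.
move=> kN; rewrite /Yword; case: ifP => // _; rewrite !mem_cat => /orP[/HP->//|/orP[]].
  by rewrite !inE => /orP[] /eqP -> /=; rewrite !leqnn ?leqnSn orbT.
by rewrite finvE mem_rev => /mapP[x /HP Hx ->]; rewrite /= Hx.
Qed.

Section Values.
Variables (G : groupType) (d : nat -> G).
Hypothesis Hd : artD_rel N d.

Let br : braid_rel N.+1 d. Proof. by case: Hd. Qed.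
Let bc : commute (d N) (d N.+1). Proof. by case: Hd. Qed.

Definition Y k : G := wval d (Yword k).
Local Notation D := (Y N).

Lemma Y_D : D = (d N)^-1 * d N.+1.
Proof. by rewrite /Y /Yword neqSn /Pword subnn /= /lval /= mulg1. Qed.

Lemma Y_last : Y N.+1 = 1.
Proof. by rewrite /Y /Yword eqxx. Qed.

Lemma Y_rec k : k < N -> Y k = Y k.+1 ^ (d k)^-1.
Proof.
move=> kN; rewrite /Y /Yword !ltn_eqF ?ltnS // ?(ltnW kN) //.
rewrite /Pword -(subnSK kN) /= finv_cons -cats1 !(wval_cat, wval_cons).
by rewrite conjgE /lval /= invgK !mulg1 !mulgA.
Qed.

Lemma Y_commute_lt i k : i.+1 < k -> k <= N -> commute (d i) (Y k).
Proof.
move=> ik kN; have iN := leq_trans ik kN.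
apply: wval_commute => x /(Yword_letters (leqW kN)) /orP[/andP[kx xN]|/andP[Nx xN]].
  by apply: br.2; rewrite ?(leq_trans ik) // ltnW.
move: xN; rewrite leq_eqVlt => /orP[/eqP ->|xN]; first by case: Hd => _ _ /(_ i iN).
by apply: br.2; rewrite ?(leq_trans iN).
Qed.

(** Downward induction on [k]; the crucial case is [i = k.+1]. There [Y k] is [Y k.+2] conjugated by
    the inverses of [d k.+1] and [d k], and a braid relation turns the extra [d k.+1] into a [d k],
    which commutes with [Y k.+2]. *)
Lemma Y_commute_gt i k : k < i -> i < N -> commute (d i) (Y k).
Proof.
move=> ki iN; have kN : k <= N by rewrite ltnW // (ltn_trans ki).
move: k kN ki; apply: down_ind => [Ni|k kN IH ki]; first by rewrite ltnNge ltnW in Ni.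
rewrite Y_rec //; move: ki; rewrite leq_eqVlt => /orP[/eqP Ei|ki].
  subst i; rewrite Y_rec // -conjgM.
  have H := Y_commute_lt (ltnSn k.+1) iN; have b := br.1 k (leqW iN).
  apply: conjg_fix_commute; rewrite -conjgM (braid_conjV b) -mulgA [LHS]conjgM.
  by rewrite (conjg_commute H).
have H1 := IH ki.
have H2 : commute (d i) (d k) by apply/commute_sym/br.2 => //; apply: leqW.
by rewrite conjgE invgK; apply: commuteM H2 (commuteM H1 (commuteV H2)).
Qed.

(** The counterpart of sigma_i sending tau_{i+1} to tau_{i+1} tau_i tau_{i+1}. *)
Lemma Y_conj_upper i : i < N -> Y i.+1 ^ d i = Y i.+1 * (Y i)^-1 * Y i.+1.
Proof.
move=> iN; rewrite (Y_rec iN).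
suff H k : k <= N -> forall i, k = i.+1 -> Y k ^ d i = Y k * (Y k ^ (d i)^-1)^-1 * Y k.
  exact: H iN i erefl.
move: k {i iN}; apply: down_ind.
  move=> i Ei; rewrite Y_D; apply: fork_conj1 => //; first by rewrite Ei; apply: br.1; rewrite -Ei.
  by case: Hd => _ _ _ /(_ i (esym Ei)).
move=> k kN IH i Ek; subst k.
have b := br.1 i (leqW kN).
have Xa : Y i.+2 ^ (d i)^-1 = Y i.+2.
  by apply/conjg_commute/commute_sym/commuteV/commute_sym/Y_commute_lt.
(* The identity one index higher is conjugated by the inverses of [d i] and [d i.+1]; since [d i]
   fixes [Y i.+2], braid relations turn every term into the one required. *)
have : (Y i.+2 ^ d i.+1) ^ ((d i)^-1 * (d i.+1)^-1) = (Y i.+2 * (Y i.+2 ^ (d i.+1)^-1)^-1 * Y i.+2)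
          ^ ((d i)^-1 * (d i.+1)^-1) by rewrite (IH i.+1 erefl).
rewrite -conjgM 2!conjMg conjVg -conjgM.
have -> : d i.+1 * ((d i)^-1 * (d i.+1)^-1) = (d i)^-1 * ((d i.+1)^-1 * d i).
  by rewrite !mulgA (braid_conjV (esym b)).
have -> : (d i.+1)^-1 * ((d i)^-1 * (d i.+1)^-1) = (d i)^-1 * ((d i.+1)^-1 * (d i)^-1).
  by rewrite !mulgA (braid_inv b).
by rewrite !(conjgM (Y i.+2) (d i)^-1) Xa (Y_rec kN) -!conjgM.
Qed.

Lemma Y_conj_braid k : k < N -> Y k ^ d N = D * Y k.
Proof.
have Dk i : i.+1 < N -> D ^ (d i)^-1 = D.
  by move=> iN; apply/conjg_commute/commute_sym/commuteV/commute_sym/Y_commute_lt.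
(* The case [k = N] is excluded, so the downward induction starts at [N.-1]. *)
case: (posnP N) => [->//|N0] kN; have : k <= N.-1 by rewrite -ltnS prednK.
move: k {kN}; apply: down_ind.
  have E : N.-1.+1 = N by rewrite prednK.
  have E' : N.-1 < N by rewrite E.
  rewrite Y_rec // E Y_D; apply: fork_conj2 => //; first by have := br.1 N.-1; rewrite E; apply.
  by case: Hd => _ _ _; apply.
move=> k kN IH; have kN' : k.+1 < N by rewrite -(prednK N0) ltnS.
have kb : commute (d N) (d k)^-1 by apply/commuteV/commute_sym/br.2.
rewrite Y_rec ?(ltnW kN') // -conjgM -kb conjgM IH conjMg Dk //.
Qed.

(** On words of even length [alt false] is Theta: exponents alternate, starting with an inverse. *)
Fixpoint alt (s : bool) (g : cword) : G :=
  if g is k :: g' then (if s then Y k else (Y k)^-1) * alt (~~ s) g' else 1.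

Lemma alt_cat s g h : alt s (g ++ h) = alt s g * alt (s (+) odd (size g)) h.
Proof.
elim: g s => [|k g IH] s; first by rewrite mul1g /= addbF.
by rewrite /= IH mulgA addNb addbN.
Qed.

(** Equal neighbours carry opposite exponents, so they cancel. *)
Lemma alt_cred s g : alt s (cred g) = alt s g.
Proof.
elim: g s => [|k g IH] s //; rewrite cred_cons [RHS]/= -IH.
case: (cred g) => [|y h] //; rewrite cconsE; case: ifP => // /negbFE/eqP ->.
by rewrite /= negbK mulgA; case: s; rewrite ?mulgV ?mulVg mul1g.
Qed.

Definition simg i k : cword :=
  if k == i then [:: i.+1] else if k == i.+1 then [:: i.+1; i; i.+1] else [:: k].

Lemma simg_alt i k : alt false (simg i k) = (alt true (simg i k))^-1.
Proof.
by rewrite /simg; do 2?[case: ifP => _]; rewrite /= ?mulg1 ?invgM ?invgK ?mulgA.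
Qed.

Lemma odd_simg i k : odd (size (simg i k)).
Proof. by rewrite /simg; do 2?[case: ifP => _]. Qed.

(* sigma_{n-1} moves the base letter tau_n used to define [Y]; this factor
   compensates for it. *)
Definition ecorr i : G := if i == N then D else 1.

Lemma Y_conj i k : i <= N -> k <= N.+1 -> Y k ^ d i = ecorr i * alt true (simg i k).
Proof.
rewrite /ecorr /simg [k <= _]leq_eqVlt leq_eqVlt => /orP[/eqP ->|iN].
  rewrite eqxx => /orP[/eqP ->|].
    by rewrite !neqSn eqxx /= Y_last conj1g mul1g !mulg1 mulgV.
  rewrite ltnS leq_eqVlt => /orP[/eqP ->|kN].
    rewrite eqxx /= Y_last !mulg1; apply: conjg_commute.
    by rewrite Y_D; apply: commuteM => //; apply/commuteV/commute_refl.
  by rewrite (ltn_eqF kN) (ltn_eqF (leqW kN)) /= mulg1 Y_conj_braid.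
rewrite (ltn_eqF iN) mul1g => /orP[/eqP ->|].
  rewrite eqSS [N.+1 == i]gtn_eqF ?(leqW iN) // [N == i]gtn_eqF //.
  by rewrite /= Y_last conj1g mulg1.
rewrite ltnS => kN.
case: eqP => [->|/eqP nki]; first by rewrite /= mulg1 (Y_rec iN) conjgKV.
case: eqP => [->|/eqP nki1]; first by rewrite /= mulg1 Y_conj_upper // mulgA.
rewrite /= mulg1; apply: conjg_commute; move: nki; rewrite neq_ltn => /orP[ki|ik].
  exact: Y_commute_gt.
by apply: Y_commute_lt => //; rewrite ltn_neqAle eq_sym nki1.
Qed.

(** Alternating exponents make the correction factors of neighbouring letters cancel; at most those
    at the two ends survive, and none does for an even word starting with an inverse. *)
Lemma alt_conj i s g : i <= N -> all (fun k => k < n) g ->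
  alt s g ^ d i = (if s then ecorr i else 1) * alt s (flatten (map (simg i) g))
                   * (if s (+) odd (size g) then ecorr i else 1)^-1.
Proof.
move=> iN; elim: g s => [|k g IH] s /=.
  by rewrite conj1g addbF mulg1 mulgV.
case/andP=> kn /IH {}IH; rewrite conjMg IH alt_cat odd_simg addbT addbN addNb !mulgA.
congr (_ * _ * _); case: s => /=; first by rewrite Y_conj // mulg1.
by rewrite conjVg Y_conj // simg_alt invgM mul1g mulgVK.
Qed.

Lemma alt_sigma i g : i <= N -> all (fun k => k < n) g -> ~~ odd (size g) ->
  alt false g ^ d i = alt false (cact (sigma n i) g).
Proof.
move=> iN Hg eg; rewrite alt_conj // mul1g (negPf eg) invg1 mulg1 /cact alt_cred.
congr (alt _ (flatten _)); apply/eq_in_map => k /(allP Hg) kn.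
by rewrite fimg_mk // /simg; do 2?[case: ifP => _].
Qed.

Lemma alt_word v g : all (fun x => x.1 < N.+1) v -> all (fun k => k < n) g -> ~~ odd (size g) ->
  alt false g ^ wval d v = alt false (cact (aeval n v).1 g).
Proof.
have cfid h : all (fun k => k < n) h -> cact (fid n) h = cred h.
  move=> Hh; have /(congr1 val) /= : tocg (cact (fid n) h) = tocg h.
    rewrite tocg_cact -ceval_tau; apply: (eq_ceval_in (P := fun k => k < n)) Hh.
    by move=> k; apply: hact_fid.
  by rewrite /cact cred_id.
have ccomp phi psi h : inBn n psi -> cact (fcomp phi psi) h = cact psi (cact phi h).
  move=> H; have /(congr1 val) /= : tocg (cact (fcomp phi psi) h) = tocg (cact psi (cact phi h)).
    by rewrite !tocg_cact hact_fcomp ceval_cact //; apply: inBn_invol H invol_tau.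
  by rewrite /cact !cred_id.
elim: v g => [|[i b] v IH] g /=; first by move=> _ Hg _; rewrite conjg1 cfid // alt_cred.
case/andP=> /= iN Hv Hg eg; have [Hp _] := aeval_inBnPhi N v.
have im : i.+1 < n by [].
have E1 : (sdlet N (i, b)).1 = if b then sigma_inv n i else sigma n i.
  by rewrite sdlet1 /= (minn_idPl _).
have Hs : inBn n (sdlet N (i, b)).1 by case: (inBnPhi_sdlet N (i, b)).
rewrite -/(sdlet N (i, b)) ccomp // -IH //; last first.
- by rewrite (odd_cact Hs).
- exact: cact_letters (inBn_endo Hs).
rewrite conjgM; congr (_ ^ _); rewrite E1 in Hs *; rewrite /lval /=.
case: b Hs {E1} => Hs; last exact: alt_sigma.
(* An inverse letter reduces to the positive one by conjugating both sides with [d i]. *)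
apply: (conjg_inj (d i)); rewrite conjgKV alt_sigma //.
- by rewrite -ccomp ?sigmaVK // ?cfid ?alt_cred //; apply: inBn_sigma.
- exact: cact_letters (inBn_endo Hs).
- by rewrite (odd_cact Hs).
Qed.

(** The last generator is [d N] times [Y N]; its inverse has the analogous form because [d N] and
    [d N.+1] commute. *)
Lemma lval_retr x : x.1 < n ->
  lval d x = lval d (minn x.1 N, x.2) * alt false (dsec N x).
Proof.
case: x => i b /=; rewrite ltnS leq_eqVlt /dsec /= => /orP[/eqP ->|iN]; last first.
  by rewrite iN (minn_idPl _) // mulg1.
rewrite ltnn minSN /lval /=; case: b; rewrite /= Y_last Y_D ?invg1 ?mulg1 ?mul1g ?mulVKg //.
by rewrite invgM invgK -(commuteV bc) mulKg.
Qed.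

(** Moving the Theta-factor of the first letter to the right past the retracted word conjugates it,
    which is exactly the twist in [sdmul]. *)
Lemma wval_retr u : is_aword n u -> wval d u = wval d (retr N u) * alt false (aeval n u).2.
Proof.
elim: u => [|x u IH]; first by rewrite /= mulg1.
case/andP=> xn /IH {}IH; rewrite wval_cons IH lval_retr // aeval_cons [sdmul _ _]/sdmul.
rewrite [retr _ _]/= wval_cons [(_, _).2]/= alt_cred alt_cat sdlet2 -!mulgA; congr (_ * _).
have Hr : all (fun y => y.1 < N.+1) (retr N u).
  by rewrite all_map; apply/allP => y _; rewrite /= ltnS geq_minr.
have Hx : all (fun k => k < n) (dsec N x) /\ ~~ odd (size (dsec N x)).
  by rewrite /dsec; case: ifP => // _; case: x.2; rewrite /= !ltnS leqnSn leqnn.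
have [Hp _] := aeval_inBnPhi N u.
rewrite (odd_cact Hp) ?Hx.1 // (negPf Hx.2) [LHS]mulgA (conjgC (alt false (dsec N x))).
rewrite (alt_word Hr) ?Hx.1 ?Hx.2 // -mulgA.
congr (_ * (alt false (cact _ _) * _)).
apply: (fendo_eq (n := n)) => [||k kn]; try exact: inBn_endo (aeval_inBnPhi N _).1.
by rewrite !hact_aeval // [retr N (retr N u)]retr_id.
Qed.

End Values.
End EvenPart.

(** * Injectivity *)

Lemma aeval_inj N u v : is_aword N.+2 u -> is_aword N.+2 v ->
  aeval N.+2 u = aeval N.+2 v -> art_eq N.+2 u v.
Proof.
move=> Hu Hv E; have Hd := dgen_artD N; have [br _ _ _] := Hd.
have Hw : is_aword N.+2 (u ++ finv v).
  by rewrite /is_aword all_cat [all _ u]Hu (all_finv (fun k => k < N.+2)) [all _ v]Hv.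
have Ew : aeval N.+2 (u ++ finv v) = sdone N.+2.
  by rewrite aeval_cat E -aeval_cat (art_eq_aeval (art_eq_finv Hv)).
have Hr : all (fun y => y.1 < N.+1) (retr N (u ++ finv v)).
  by rewrite all_map; apply/allP => y _; rewrite /= ltnS geq_minr.
have R1 : wval (@dgen N.+2) (retr N (u ++ finv v)) = 1.
  apply: (braid_faithful Hr) br => x; apply: funext => k.
  have [kn|kn] := ltnP k N.+2; last exact: hur_word_fix Hr kn.
  by rewrite -hact_aeval // Ew hact_fid.
have := wval_retr Hd Hw; rewrite R1 Ew mulg1 wval_cat wval_finv => /divg1_eq.
by rewrite !wval_dgen => /artclassP; rewrite !alph_id.
Qed.

(** * Generation of B_n by Artin's length reduction *)

Lemma sorted_join (T : Type) (e : rel T) u x y v :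
  sorted e (rcons u x) -> sorted e (y :: v) -> e x y -> sorted e (rcons u x ++ y :: v).
Proof. by rewrite cat_rcons sorted_cat_cons /= => -> -> ->. Qed.

Lemma size_fred w : size (fred w) <= size w.
Proof.
elim: w => [|x w IH] //; rewrite fred_cons; case: (fred w) IH => [|y v] // IH.
by rewrite fconsE; case: ifP => //= _; rewrite ltnW // ltnW.
Qed.

Definition cj (a : fword * nat) : fword := finv a.1 ++ (a.2, false) :: a.1.

Lemma wval_cj (G : groupType) (x : nat -> G) a : wval x (cj a) = x a.2 ^ wval x a.1.
Proof. exact: wvalJw. Qed.

Lemma size_cj a : size (cj a) = (size a.1).*2.+1.
Proof. by rewrite size_cat size_finv /= addnS addnn. Qed.

Lemma cj_form w p : exists v, fred (cj (w, p)) = cj (v, p).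
Proof.
have -> : fred (cj (w, p)) = fred (cj (fred w, p)).
  by apply/tofree_eqP; rewrite -!wval_tgen !wval_cj wval_fred.
elim: (fred w) (fred_reduced w) => [|x v IH] Hv; first by exists [::].
have [Ex|nx] := eqVneq x.1 p.
  have [u Eu] := IH (path_sorted Hv); exists u; rewrite -Eu.
  apply/tofree_eqP; rewrite -!wval_tgen !wval_cj wval_cons conjgM; congr (_ ^ _).
  by apply: conjg_commute; rewrite /lval -Ex; case: x.2; [apply/commute_sym/commuteV|].
exists (x :: v); apply/freducedP; rewrite /cj sorted_cat_cons.
have nc b : compat (p, b) x.
  by rewrite /compat; apply: contra nx => /eqP ->.
rewrite -[(p, false) as y in rcons _ y]/(flip (p, true)) -finv_cons finv_reduced /=.
by rewrite !nc [path _ _ _]Hv.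
Qed.

Lemma common_suffix (u v : fword) : exists u1 v1 s,
  [/\ u = u1 ++ s, v = v1 ++ s
    & forall u' x v' y, u1 = rcons u' x -> v1 = rcons v' y -> x != y].
Proof.
elim/last_ind: u v => [|u x IH] v.
  by exists [::], v, [::]; split; rewrite ?cats0 // => -[].
case/lastP: v => [|v y]; first by exists (rcons u x), [::], [::]; split; rewrite ?cats0 // => u' ? [].
have [->|nxy] := eqVneq x y.
  have [u1 [v1 [s [-> -> H]]]] := IH v.
  by exists u1, v1, (rcons s y); rewrite !rcons_cat.
exists (rcons u x), (rcons v y), [::]; split; rewrite ?cats0 // => u' x' v' y'.
by move=> /rcons_inj[_ <-] /rcons_inj[_ <-].
Qed.

(** The first clause says that the letters after the centre of [cj a] do not cancel the centre of
    [cj b]; the second is its mirror. *)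
Definition noabs (a b : fword * nat) :=
  ~~ suffix ((b.2, true) :: b.1) a.1 && ~~ suffix ((a.2, false) :: a.1) b.1.

(* When no central letter is absorbed by a neighbour, the product of the
   conjugates is reduced up to cancellations strictly between central letters. *)
Lemma noabs_prod l a : path noabs a l -> all (fun b => sorted compat (cj b)) (a :: l) ->
  exists R, [/\ sorted compat (finv a.1 ++ (a.2, false) :: R),
     tofree (flatten (map cj (a :: l))) = tofree (finv a.1 ++ (a.2, false) :: R),
     size l <= size R
   & size R <= size l -> R = map (fun b => (b.2, false)) l /\ all (fun b => b.1 == [::]) (a :: l)].
Proof.
elim: l a => [|b l IH] a.
  move=> _ /andP[Ha _]; exists a.1; split=> //; first by rewrite /= cats0.
  by rewrite leqn0 size_eq0 => /eqP Ea; rewrite Ea /= Ea.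
rewrite [path _ _ _]/= => /andP[ab bl] /andP[Ha Hbl].
have [R [HR ER sR eR]] := IH b bl Hbl.
have [w1 [v1 [s [Ea Eb Hs]]]] := common_suffix a.1 b.1.
(* The common suffix of the two conjugators cancels; [w1] and the inverse of [v1] remain between the
   centres. *)
exists (w1 ++ finv v1 ++ (b.2, false) :: R); split.
- rewrite -cat_cons catA.
  have H1 : sorted compat (finv a.1 ++ (a.2, false) :: w1).
    by move: Ha; rewrite /cj {2}Ea -cat_cons catA => /cat_sorted2[].
  have H2 : sorted compat (finv v1 ++ (b.2, false) :: R).
    by move: HR; rewrite Eb finv_cat -catA => /cat_sorted2[].
  (* At the junction, both parts empty gives two positive centres, exactly one empty is the
     absorption excluded by [ab], and both nonempty is handled by maximality of the common
     suffix. *)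
  case/lastP: w1 Ea Hs H1 => [|w' x] Ea Hs; rewrite ?cats1 -?rcons_cons -?rcons_cat => H1;
    case/lastP: v1 Eb Hs H2 => [|v' y] Eb Hs; rewrite ?finv_rcons ?cat_cons => H2;
    apply: sorted_join => //; rewrite /compat.
  + by rewrite /flip xpair_eqE andbF.
  + rewrite (inj_eq (inv_inj flipK)); apply: contraTneq ab => Ey.
    by rewrite negb_and !negbK Eb Ea cat_rcons Ey suffix_suffix orbT.
  + apply: contraTneq ab => Ex.
    by rewrite negb_and !negbK Eb Ea cat_rcons -[x]flipK -Ex suffix_suffix.
  + by rewrite (inj_eq (inv_inj flipK)) eq_sym (Hs w' x v' y).
- have -> : tofree (flatten (map cj (a :: b :: l))) = tofree (cj a) * tofree (flatten (map cj (b :: l))).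
    by rewrite -!wval_tgen -wval_cat.
  rewrite ER -!wval_tgen wval_cj !(wval_cat, wval_cons, wval_finv).
  by rewrite conjgE {2}Ea Eb !wval_cat invgM -!mulgA mulVKg.
- by rewrite !size_cat size_finv /= addnA addnS ltnS (leq_trans sR) // leq_addl.
- rewrite !size_cat /= size_finv !addnS ltnS => Hsz.
  have Hw : size w1 + size v1 = 0.
    by apply/eqP; rewrite -leqn0 -(leq_add2r (size l)) add0n (leq_trans _ Hsz) // addnA leq_add2l.
  have [Ew Ev] : w1 = [::] /\ v1 = [::].
    by move/eqP: Hw; rewrite addn_eq0 !size_eq0 => /andP[/eqP-> /eqP->].
  rewrite Ew Ev /= in Ea Eb Hsz *; have [-> Hl] := eR Hsz; split=> //.
  by apply/andP; split=> //; move/andP: Hl => []; rewrite Ea -Eb.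
Qed.

(** The [n] centres already account for the length of t_1 ... t_n, so the conjugators are empty and
    the centres come in order. *)
Lemma noabs_fid n (f : nat -> fword * nat) :
    (forall k, k < n -> sorted compat (cj (f k))) ->
    (forall k, k.+1 < n -> noabs (f k) (f k.+1)) ->
    tofree (flatten [seq cj (f k) | k <- iota 0 n]) = tofree (tword n) ->
  forall k, k < n -> f k = ([::], k).
Proof.
case: n => // n Hf Hn E.
have pl : path noabs (f 0) (map f (iota 1 n)).
  apply/(pathP ([::], 0)) => i; rewrite size_map size_iota => iN.
  rewrite -[f 0 :: _]/(map f (iota 0 n.+1)) !(nth_map 0) ?size_iota // ?leqW //.
  by rewrite !nth_iota // ?leqW // add0n add1n; apply: Hn.
have al : all (fun b => sorted compat (cj b)) (f 0 :: map f (iota 1 n)).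
  by rewrite -[f 0 :: _]/(map f (iota 0 n.+1)) all_map; apply/allP => k; rewrite mem_iota; apply: Hf.
have [R [HR ER sR eR]] := noabs_prod pl al.
have Etw : finv (f 0).1 ++ ((f 0).2, false) :: R = tword n.+1.
  have : fred (finv (f 0).1 ++ ((f 0).2, false) :: R) = fred (tword n.+1).
    by apply/tofree_eqP; rewrite -ER -E -[f 0 :: _]/(map f (iota 0 n.+1)) -map_comp.
  rewrite (reduced_fred HR) => ->; apply: reduced_fred.
  by have /andP[/eqP/freducedP] := z1_fword n.+1; rewrite finv_reduced.
have := congr1 size Etw; rewrite size_cat size_finv size_map size_iota /= addnS => -[sz].
have [] := eR; first by rewrite size_map size_iota -sz leq_addl.
rewrite -[f 0 :: _]/(map f (iota 0 n.+1)) all_map => ERl /allP Hnil k kn.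
have Hk j : j < n.+1 -> (f j).1 = [::].
  by move=> jn; apply/eqP/(Hnil j); rewrite mem_iota.
rewrite [LHS]surjective_pairing Hk //; congr pair.
rewrite Hk //= ERl -[_ :: _]/(map (fun b => (b.2, false)) (map f (iota 0 n.+1))) in Etw.
have := congr1 (fun w => nth 0 (map fst w) k) Etw.
rewrite /tword -!map_comp !(nth_map 0) ?size_iota //= -/(iota 0 n.+1).
by rewrite nth_iota.
Qed.

Lemma sum_lt2 n (f g : nat -> nat) k : k.+1 < n ->
    (forall j, j < n -> j != k -> j != k.+1 -> f j = g j) -> f k + f k.+1 < g k + g k.+1 ->
  \sum_(j < n) f j < \sum_(j < n) g j.
Proof.
move=> kn E lt; pose a := Ordinal (ltnW kn); pose b := Ordinal kn.
have ba : b != a by rewrite -val_eqE /= neqSn.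
rewrite (bigD1 a) //= (bigD1 b) //= [ltnRHS](bigD1 a) //= [in ltnRHS](bigD1 b) //= !addnA.
rewrite -addSn; apply: leq_add => //; apply/eq_leq/eq_bigr => j /andP[ja jb].
by apply: E.
Qed.

Section Generation.
Variable N : nat.
Local Notation n := N.+2.

Definition flen (phi : fendo) := \sum_(j < n) size (fimg phi j).

Lemma descent phi : inBn n phi -> phi = fid n \/
  exists2 k, k < N.+1 & (flen (fcomp (sigma n k) phi) < flen phi)
                     || (flen (fcomp (sigma_inv n k) phi) < flen phi).
Proof.
move=> H; have He := inBn_endo H.
have /choice[f Hf] : forall k, exists a, k < n -> fimg phi k = cj a.
  move=> k; have [kn|kn] := ltnP k n; last by exists ([::], 0).
  case: H => _ [_ [p [w Hp]]].
  have [v Ev] := cj_form (nth [::] w k) (p (Ordinal kn)).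
  by exists (v, nat_of_ord (p (Ordinal kn))); rewrite (Hp (Ordinal kn)) -Ev.
have Sf k : k < n -> sorted compat (cj (f k)).
  move=> kn; rewrite -Hf //; apply/freducedP/eqP.
  by case/is_endoP: He => _ /(_ k kn) /andP[].
have hf k : k < n -> hact phi tgen k = tgen (f k).2 ^ wval tgen (f k).1.
  by move=> kn; rewrite /hact Hf // wval_cj.
have szf k : k < n -> size (fimg phi k) = (size (f k).1).*2.+1.
  by move=> kn; rewrite Hf // size_cj.
have [noab|] := pselect (forall k, k.+1 < n -> noabs (f k) (f k.+1)).
  left; have Ef : forall k, k < n -> f k = ([::], k).
    apply: noabs_fid => //.
    have -> : [seq cj (f k) | k <- iota 0 n] = [seq fimg phi k | k <- iota 0 n].
      by apply/eq_in_map => k; rewrite mem_iota => /andP[_ kn]; rewrite Hf.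
    have E : wval (hact phi tgen) (z1 n) = wval tgen (z1 n).
      have Hz : fapp phi (z1 n) = z1 n by case: H => _ [].
      by rewrite -wval_fapp Hz.
    rewrite -!wval_tgen; apply: invg_inj; rewrite -[RHS]wval_finv -[RHS]E wval_finv; congr _^-1.
    rewrite -(wval_fsubst tgen (fimg phi)) /fsubst /tword -map_comp; congr (wval _ (flatten _)).
  apply: (fendo_eq (n := n)) He (fid_endo n) _ => k kn.
  by rewrite hf // Ef //= conjg1 hact_fid.
move=> /existsNP[k /not_implyP[kn /negP]]; rewrite negb_and !negbK => Hab.
right; exists k => //; apply/orP; have kn' := ltnW kn.
have szle psi j u p : hact psi (hact phi tgen) j = tgen p ^ wval tgen u ->
    size (fimg (fcomp psi phi) j) <= (size u).*2.+1.
  rewrite -hact_fcomp -(wval_cj tgen (u, p)) /hact !wval_tgen => /tofree_eqP E.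
  have -> : fimg (fcomp psi phi) j = fred (cj (u, p)) by rewrite -E fimg_fcomp fred_id.
  by rewrite (leq_trans (size_fred _)) // size_cj.
have szeq psi j j' : j' < n -> hact psi (hact phi tgen) j = hact phi tgen j' ->
    size (fimg (fcomp psi phi) j) = size (fimg phi j').
  have E0 : fred (fimg (fcomp psi phi) j) = fimg (fcomp psi phi) j by rewrite fimg_fcomp fred_id.
  rewrite -hact_fcomp /hact !wval_tgen => j'n /tofree_eqP.
  by rewrite E0 [fimg phi j']Hf // (reduced_fred (Sf _ j'n)) => ->.
case/orP: Hab => /suffixP[w Ew].
(* The conjugator of image [k] contains the inverse centre of image [k.+1]; conjugating by that
   image, as [sigma] does, removes this letter. *)
- left; apply: (@sum_lt2 n (fun j => size (fimg (fcomp (sigma n k) phi) j))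
                    (fun j => size (fimg phi j)) k) => // [j jn jk jk1|].
    by apply: szeq => //; rewrite hact_sigma // /hur (negPf jk) (negPf jk1).
  rewrite (szeq _ k k.+1) ?hact_sigma // /hur ?eqxx // addnC ltn_add2r.
  apply: leq_ltn_trans (szle _ k.+1 (w ++ (f k.+1).1) (f k).2 _) _.
    rewrite hact_sigma // /hur neqSn eqxx !hf // Ew !wval_cat wval_cons -conjgM; congr (_ ^ _).
    by rewrite conjgE /lval /= !mulgA mulgK mulgVK.
  by rewrite szf // Ew !size_cat /= addnS doubleS.
(* Symmetrically, [sigma_inv] removes the centre of image [k] from the conjugator of image
   [k.+1]. *)
- right; apply: (@sum_lt2 n (fun j => size (fimg (fcomp (sigma_inv n k) phi) j))
                     (fun j => size (fimg phi j)) k) => // [j jn jk jk1|].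
    by apply: szeq => //; rewrite hact_sigma_inv // /hurV (negPf jk) (negPf jk1).
  rewrite (szeq _ k.+1 k) ?hact_sigma_inv // /hurV ?neqSn ?eqxx // addnC ltn_add2l.
  apply: leq_ltn_trans (szle _ k (w ++ (f k).1) (f k.+1).2 _) _.
    rewrite hact_sigma_inv // /hurV eqxx !hf // Ew !wval_cat wval_cons -conjgM; congr (_ ^ _).
    by rewrite conjgE !invgM !invgK /lval /= -!mulgA mulVKg mulVKg.
  by rewrite szf // Ew !size_cat /= addnS doubleS.
Qed.

Lemma sigma_generate phi : inBn n phi ->
  exists2 u, all (fun x => x.1 < N.+1) u & (aeval n u).1 = phi.
Proof.
elim: (flen phi) {-2}phi (leqnn (flen phi)) => [|L IH] {}phi HL H.
all: have [->|[k kN Hk]] := descent H; first by exists [::].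
  by rewrite leqn0 in HL; move: Hk; rewrite (eqP HL).
have kn : k.+1 < n by [].
have cons b psi psi' : (sdlet N (k, b)).1 = psi' -> inBn n psi -> fcomp psi' psi = fid n ->
    flen (fcomp psi phi) < flen phi ->
  exists2 u, all (fun x => x.1 < N.+1) u & (aeval n u).1 = phi.
  move=> E Hpsi K lt; have [||u Hu Eu] := IH (fcomp psi phi).
  - by rewrite -ltnS (leq_trans lt).
  - exact: inBn_fcomp.
  exists ((k, b) :: u); first by rewrite /= kN.
  by rewrite aeval_cons /= E Eu fcompA K (fcomp1l (inBn_endo H)).
have mk : minn k N = k by apply/minn_idPl.
case/orP: Hk => lt.
  apply: (cons true _ (sigma_inv n k)) lt; first by rewrite sdlet1 /= mk.
    exact: inBn_sigma.
  exact: sigmaVK.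
apply: (cons false _ (sigma n k)) lt; first by rewrite sdlet1 /= mk.
  exact: inBn_sigma_inv.
exact: sigmaK.
Qed.

(** * The even subgroup in the image, and surjectivity *)

Lemma hur_Pword_last (G : groupType) (x : nat -> G) k : k <= N ->
  wval (@hurB G) (finv (Pword N k)) x N = x k.
Proof.
move=> kN; move: k kN x; apply: down_ind => [|k kN IH] x; first by rewrite /Pword subnn.
rewrite /Pword -(subnSK kN) /= finv_cons -cats1 wval_cat wval1 bij_mulE.
by rewrite -/(Pword N k.+1) IH /= /hurV neqSn eqxx.
Qed.

(** Words over the identity of B_n; on them the second component is multiplicative without a
    twist. *)
Definition pure (u : aword) (g : cgrp) :=
  [/\ is_aword n u, (aeval n u).1 = fid n & tocg (aeval n u).2 = g].

Lemma pure_cat u v g h : pure u g -> pure v h -> pure (u ++ v) (g * h).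
Proof.
case=> Hu Eu <- [Hv Ev <-]; split.
- by rewrite /is_aword all_cat [all _ u]Hu.
- by rewrite aeval_cat /= Eu Ev (fcomp1 (fid_endo n)).
- rewrite aeval_cat tocg_sdmul Ev -[tocg (aeval n u).2]ceval_tau; congr (_ * _).
  apply: (eq_ceval_in (P := fun k => k < n)) => [k|]; first exact: hact_fid.
  by case: (aeval_inBnPhi N u) => _ [/andP[]].
Qed.

Lemma pure_inv u g : pure u g -> pure (finv u) g^-1.
Proof.
case=> Hu Eu <-; have Hf : is_aword n (finv u) by rewrite /is_aword (all_finv (fun k => k < n)).
have := art_eq_aeval (art_eq_finv Hu); rewrite aeval_cat => E.
have E1 : (aeval n (finv u)).1 = fid n.
  have := congr1 fst E; rewrite /= Eu => <-.
  by rewrite (fcomp1l (inBn_endo (aeval_inBnPhi N (finv u)).1)).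
split=> //; apply/esym/mulg1_eq.
have [_ _ <-] := pure_cat (And3 Hu Eu erefl) (And3 Hf E1 erefl).
by rewrite aeval_cat E; apply: val_inj.
Qed.

(** Under the retraction the middle pair cancels, so the automorphism part is trivial. The pair
    [tau N.+1], [tau N] is then acted on by the inverse prefix, which replaces [N] by [k] and fixes
    [N.+1]. *)
Lemma pure_Yword k : k < n -> pure (Yword N k) (tau N.+1 * tau k).
Proof.
rewrite ltnS leq_eqVlt => /orP[/eqP ->|kN].
  rewrite /Yword eqxx invol_tau; split=> //; exact: val_inj.
have HP : all (fun x => x.1 < N) (Pword N k).
  rewrite all_map; apply/allP => i; rewrite mem_iota => /andP[_].
  by rewrite /= subnKC.
have HP' : all (fun x => x.1 < N.+1) (Pword N k) by apply: sub_all HP => x /ltnW.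
have HfP' : all (fun x => x.1 < N.+1) (finv (Pword N k)) by rewrite (all_finv (fun k => k < N.+1)).
have EY : Yword N k = Pword N k ++ [:: (N, true); (N.+1, false)] ++ finv (Pword N k).
  by rewrite /Yword ltn_eqF.
split.
- apply/allP => x /(Yword_letters (ltnW kN)) /orP[/andP[_]|/andP[_]] //.
  by move=> xN; rewrite ltnW // ltnW.
- apply: (fendo_eq (n := n)) (fid_endo n) _ => [|j jn].
    exact: inBn_endo (aeval_inBnPhi N _).1.
  rewrite hact_aeval // hact_fid // EY.
  suff -> : wval (@hurB freegrp)
      (retr N (Pword N k ++ [:: (N, true); (N.+1, false)] ++ finv (Pword N k))) = 1 by [].
  rewrite [retr _ _]map_cat map_cat [map _ (Pword _ _)](retr_id HP').
  rewrite [map _ (finv _)](retr_id HfP') !wval_cat wval_finv /= minnn minSN.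
  by rewrite /lval /= mulg1 mulVg mul1g mulgV.
- rewrite EY; set u := [:: _; _] ++ _.
  have Etr v w : all (fun x => x.1 < N.+1) v -> tocg (aeval n (v ++ w)).2 = tocg (aeval n w).2.
    elim: v => [|x v IH] //= /andP[xN /IH E]; rewrite -E.
    by rewrite -/(aeval n (x :: v ++ w)) aeval2_cons /dsec xN mul1g.
  rewrite Etr // /u !cat_cons cat0s 2!aeval2_cons aeval2_braid // /dsec /= ltnn ltnSn mul1g mulg1.
  rewrite retr_id //= hur_Pword_last // mulg1; congr (_ * _).
  have := @hur_word_fix _ N (finv (Pword N k)) tau N.+1; apply=> //.
  by rewrite (all_finv (fun k => k < N)).
Qed.

Lemma pure_even g : all (fun k => k < n) g -> ~~ odd (size g) -> exists u, pure u (tocg g).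
Proof.
elim: (size g) {-2}g (leqnn (size g)) => [|m IH] {}g sg Hg eg.
  move: sg; rewrite leqn0 size_eq0 => /eqP ->; exists [::]; split=> //; exact: val_inj.
case: g sg Hg eg => [|a [|b g]] //; first by move=> *; exists [::]; split=> //; apply: val_inj.
rewrite /= negbK ltnS => sg /andP[an /andP[bn Hg]] eg.
have [u Hu] := IH g (ltnW sg) Hg eg.
exists ((finv (Yword N a) ++ Yword N b) ++ u).
have -> : tocg [:: a, b & g] = (tau N.+1 * tau a)^-1 * (tau N.+1 * tau b) * tocg g.
  by rewrite -!ceval_tau /= invgM !involVtau -!mulgA tauK.
by apply: pure_cat Hu; apply: pure_cat (pure_Yword bn); apply/pure_inv/pure_Yword.
Qed.

Lemma aeval_surj x : inBnPhi n x -> exists u, is_aword n u /\ aeval n u = x.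
Proof.
move=> Hx; case: x Hx => phi g /= Hx; have [/= H [/andP[/eqP Eg Hg] eg]] := Hx.
have [u Hu Eu] := sigma_generate H; have [v [Hv Ev1 Ev2]] := pure_even Hg eg.
have Hu' : is_aword n u by apply: sub_all Hu => y /leqW.
(* The braid word [u] supplies the automorphism and has trivial second component; the pure word [v]
   supplies [g]. *)
exists (u ++ v); split; first by rewrite /is_aword all_cat [all _ u]Hu'.
apply: (sd_eq (aeval_inBnPhi N _) Hx) => [k kn|].
  by rewrite aeval_cat /= Eu Ev1 (fcomp1 (inBn_endo H)).
rewrite aeval_cat tocg_sdmul Ev1 Ev2 -[RHS]mul1g; congr (_ * _).
rewrite -(aeval2_braid Hu) -ceval_tau.
apply: (eq_ceval_in (P := fun k => k < n)) => [k|]; first exact: hact_fid.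
by case: (aeval_inBnPhi N u) => _ [/andP[]].
Qed.

End Generation.

(** The isomorphism is expressed on words: it is well defined, injective, takes values in the
    subgroup, and is onto; multiplicativity is [aeval_cat]. *)
Theorem theorem9p3 (n : nat) (hn : 2 <= n) :
  [/\ (forall u v, is_aword n u -> is_aword n v -> art_eq n u v -> aeval n u = aeval n v),
      (forall u v, is_aword n u -> is_aword n v -> aeval n u = aeval n v -> art_eq n u v),
      (forall u, is_aword n u -> inBnPhi n (aeval n u))
    & (forall x, inBnPhi n x -> exists u, is_aword n u /\ aeval n u = x)].
Proof.
case: n hn => [|[|N]] // _; split.
- by move=> u v _ _; apply: art_eq_aeval.
- exact: aeval_inj.
- by move=> u _; apply: aeval_inBnPhi.
- exact: aeval_surj.
Qed.
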